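(* Let $\mathcal{H}$ be a separable, infinite dimensional complex Hilbert space. For $M=\mathbb{R}_{+}$ (continuous time) and for $M=\mathbb{N}_{0}$ (discrete time), the space $\mathcal{C}_{s}(M)$ of contractive $C_{0}$-semigroups over $\mathcal{H}$ on $M$, endowed with the topology of uniform WOT-convergence on compact subsets of $M$, is a Baire space.
   Context: $\mathbb{R}_{+}=[0,\infty)$ and $\mathbb{N}_{0}=\{0,1,2,\dots\}$ are regarded as topological monoids $(\mathbb{R}_{+},+,0)$ (usual topology) and $(\mathbb{N}_{0},+,0)$ (discrete topology). $\mathcal{C}(\mathcal{H})$ denotes the set of contractions, i.e. bounded linear operators on $\mathcal{H}$ of norm at most $1$. SOT and WOT denote the strong and weak operator topologies. For $M\in\{\mathbb{R}_{+},\mathbb{N}_{0}\}$, $\mathcal{C}_{s}(M)$ is the set of SOT-continuous functions $T:M\to\mathcal{C}(\mathcal{H})$ satisfying $T(0)=I$ and $T(s+t)=T(s)T(t)$ for all $s,t\in M$ (for $M=\mathbb{N}_{0}$ the continuity requirement is vacuous). The topology of uniform WOT-convergence on compact subsets of $M$ is defined by: a net $(T_{i})_{i}$ converges to $T$ if and only if for all $\xi,\eta\in\mathcal{H}$ and all compact $K\subseteq M$, $\sup_{t\in K}|\langle (T_{i}(t)-T(t))\xi,\eta\rangle|\to 0$. A topological space is a Baire space if every countable intersection of dense open subsets is dense. *)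

(* Defs.v *)
From HB Require Import structures.
From mathcomp Require Import all_boot all_order all_algebra.
From mathcomp Require Import sesquilinear complex.
From mathcomp Require Import all_classical all_reals all_analysis.

Set Implicit Arguments.
Unset Strict Implicit.
Unset Printing Implicit Defensive.

Import Order.TTheory GRing.Theory Num.Theory numFieldNormedType.Exports.

Local Open Scope classical_set_scope.
Local Open Scope ring_scope.

Definition baire_space (T : topologicalType) :=
  forall U : nat -> set T, (forall n, open (U n) /\ dense (U n)) ->
    dense (\bigcap_n U n).

Definition separable_space (T : topologicalType) :=
  exists2 D : set T, countable D & dense D.

Definition finite_dimensional (K : nzRingType) (V : lmodType K) :=
  exists (n : nat) (e : 'I_n -> V),
    forall x, exists c : 'I_n -> K, x = \sum_(i < n) c i *: e i.

Record rplus (R : realType) := RPlus { rval :> R; rval_ge0 : 0 <= rval }.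

Section rplus_structures.
Variable R : realType.
Local Notation rplus := (rplus R).

HB.instance Definition _ := [isSub for @rval R].
HB.instance Definition _ := [Choice of rplus by <:].

Definition rplus0 : rplus := RPlus (lexx 0).
Definition rplusD (s t : rplus) : rplus :=
  RPlus (addr_ge0 (rval_ge0 s) (rval_ge0 t)).

Lemma rplusA : associative rplusD.
Proof. by move=> s t u; apply: val_inj; rewrite /= addrA. Qed.
Lemma rplusC : commutative rplusD.
Proof. by move=> s t; apply: val_inj; rewrite /= addrC. Qed.
Lemma rplus0D : left_id rplus0 rplusD.
Proof. by move=> s; apply: val_inj; rewrite /= add0r. Qed.

HB.instance Definition _ := GRing.isNmodule.Build rplus rplusA rplusC rplus0D.
HB.instance Definition _ := Topological.copy rplus (initial_topology (@rval R)).

Lemma rplus_add_continuous : continuous (fun x : rplus * rplus => x.1 + x.2).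
Proof.
apply: continuous_comp_initial => -[s t].
have cv (r : rplus) : {for r, continuous (@rval R)}.
  exact: initial_continuous.
apply: (@cvgD _ R^o); apply: continuous_comp; do ?exact: cv.
  exact: cvg_fst.
exact: cvg_snd.
Qed.

HB.instance Definition _ :=
  PreTopologicalNmodule_isTopologicalNmodule.Build rplus rplus_add_continuous.
End rplus_structures.

Lemma nat_add_continuous : continuous (fun x : nat * nat => (x.1 + x.2)%R).
Proof.
move=> [m n] A /principal_filterP mnA.
exists ([set m], [set n]) => /=; first by split; exact/principal_filterP.
by move=> [i j] /= [-> ->].
Qed.
HB.instance Definition _ :=
  PreTopologicalNmodule_isTopologicalNmodule.Build nat nat_add_continuous.

Lemma initial_cvgP (S : choiceType) (T : topologicalType) (w : S -> T)
    (F : set_system S) (x : S) : Filter F ->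
  F --> (x : initial_topology w) <-> w @ F --> w x.
Proof.
move=> FF; split=> [Fx|cx].
  exact: cvg_comp Fx (@initial_continuous _ _ _ _).
move=> U [_ [[W oW <-] /= Wx] /filterS]; apply; apply: cx.
exact: open_nbhs_nbhs.
Qed.

Section semigroups.
Variables (R : realType) (H : completeNormedModType R[i]).
Local Notation C := R[i].

(* The norm of [H] is [C]-valued with nonnegative real values; [complex.Re] *)
(* reads it as an element of [R]. An unbounded [A] has norm [+oo].         *)
Definition op_norm (A : H -> H) : \bar R :=
  ereal_sup [set (complex.Re `|A x|)%:E | x in [set x : H | `|x| <= 1]].

Definition contraction (A : H -> H) := linear A /\ (op_norm A <= 1)%E.

Definition sot_continuous (M : topologicalType) (T : M -> H -> H) :=
  forall xi : H, continuous (T ^~ xi).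

Definition contractive_semigroup (M : TopologicalNmodule.type) :
    set (M -> H -> H) :=
  [set T | [/\ forall t, contraction (T t), sot_continuous T, T 0 = id
    & forall s t, T (s + t) = T s \o T t]].

End semigroups.
Arguments contractive_semigroup {R} H M.

Section Cs_topology.
Variables (R : realType) (H : completeNormedModType R[i]).
Local Notation C := R[i].
Variables (dot : {dot H for @Num.conj C}) (M : TopologicalNmodule.type).

Definition matrix_coeff (T : contractive_semigroup H M) :
    {ptws (H * H) -> {family compact, M -> C^o}} :=
  fun p t => dot (val T t p.1) p.2.

(* The initial topology for all the maps [T |-> (t |-> <T(t) xi, eta>)],    *)
(* where the target carries uniform convergence on compact subsets of [M].  *)
Definition Cs : Type := initial_topology matrix_coeff.

HB.instance Definition _ := Topological.copy Cs (initial_topology matrix_coeff).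

Lemma Cs_cvgP (F : set_system Cs) (T : Cs) : Filter F ->
  F --> T <->
  forall (xi eta : H) (K : set M), compact K -> forall e : R, 0 < e ->
    \forall S \near F, (ereal_sup
      [set (complex.Re `|dot (val S t xi - val T t xi) eta|)%:E | t in K]
        <= e%:E)%E.
Proof.
move=> FF.
have ReC (z : C) : ((complex.Re `|z|)%:C)%C = `|z|.
  by rewrite RRe_real ?normr_real.
rewrite initial_cvgP cvg_sup; split=> [cT xi eta K cK e e0|cT [xi eta]].
  move: (cT (xi, eta)) => /initial_cvgP/fam_cvgP/(_ K cK).
  pose E := [set ab : C^o * C^o | `|ab.1 - ab.2| < (e%:C)%C].
  have entE : entourage E.
    rewrite -entourage_from_ballE; exists (e%:C)%C => /=; first by rewrite ltcR.
    by move=> [a b].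
  pose A := [set g : M -> C^o |
    forall t, K t -> E (matrix_coeff T (xi, eta) t, g t)].
  have nA : nbhs (matrix_coeff T (xi, eta) : {uniform` K -> C^o}) A.
    by apply/uniform_nbhs; exists E; split.
  move=> /(_ A nA) FA; near=> S.
  have ES : A (matrix_coeff S (xi, eta)) by near: S.
  apply: ub_ereal_sup => _ [t Kt <-].
  rewrite lee_fin -lecR ReC linearBl -normrN opprB ltW //.
  exact: ES.
apply/initial_cvgP/fam_cvgP => K cK U /uniform_nbhs[E [entE EU]].
move: entE; rewrite -entourage_from_ballE => -[e /= e0 eE].
have eR : ((complex.Re e)%:C)%C = e by rewrite RRe_real ?gtr0_real.
have e20 : 0 < complex.Re e / 2 by rewrite divr_gt0 // -ltcR eR.
apply: filterS (cT xi eta K cK _ e20) => S /= supS; apply: EU => t Kt.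
apply: eE; rewrite /ball/= -normrN opprB -linearBl -ReC -eR ltcR.
apply: (@le_lt_trans _ _ (complex.Re e / 2)); last first.
  by rewrite ltr_pdivrMr// ltr_pMr ?ltr1n// -ltcR eR.
rewrite -lee_fin; apply: le_trans supS; apply: ereal_sup_ubound.
by exists t.
Unshelve. all: by end_near. Qed.
End Cs_topology.
Arguments Cs {R H} dot M.

(* Main.v *)
Require Import Defs.
From HB Require Import structures.
From mathcomp Require Import all_boot all_order all_algebra.
From mathcomp Require Import sesquilinear complex.
From mathcomp Require Import all_classical all_reals all_analysis.
From mathcomp Require Import ring.

(* A space with a dense Baire subspace is Baire, and the isometric semigroups *)
(* form such a subspace.                                                      *)
(* Density: by Sz.-Nagy, the kernel ((t,x),(s,y)) |-> <T(t-s)x, y> for t >= s *)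
(* is positive semidefinite. Restricted to finitely many vectors x and a      *)
(* countable dense set of times, it is the Gram kernel of vectors that can be *)
(* chosen inside H itself, extending the given x at t = 0, because dim H is   *)
(* infinite. Translation of times is isometric on their closed span, and the  *)
(* identity on the orthogonal complement completes it to an isometric         *)
(* semigroup V on H with <V(t)x, y> = <T(t)x, y> for the chosen vectors.      *)
(* Baire property: for vectors of equal norm, weak closeness gives norm       *)
(* closeness, so nested weak neighbourhoods of isometric semigroups can be    *)
(* shrunk until their centres converge strongly, uniformly on compact sets,   *)
(* to an isometric semigroup in their intersection.                           *)

(** Density is [isometric_dense]. Positivity of the kernel ([dil_ker_ge0]) comes from contractivity
    by completing squares along increasing times; [gram_realization] places the Gram vectors in [H],
    [isometric_semigroup_extension] turns translation of times into a semigroup, and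
    [isometric_dilation] joins these facts. The dilation keeps finitely many coefficients of [T]
    exactly, at all times at once, so it lies in any given basic neighbourhood. The passage from
    weak to strong closeness is [nbhs_isometric_sot]; [isometric_limit] supplies the point of the
    intersection, and [Cs_baire] runs the nested construction directly in the whole space, with
    isometric centres. Both monoids are treated together through [time_axis]: a total order with
    continuous truncated subtraction, a dense sequence and an exhaustion by compact sets. *)

Set Implicit Arguments.
Unset Strict Implicit.
Unset Printing Implicit Defensive.

Import Order.TTheory GRing.Theory Num.Theory numFieldNormedType.Exports.

Local Open Scope classical_set_scope.
Local Open Scope ring_scope.

(** * Hilbert space geometry *)

Lemma dotC (C : numClosedFieldType) (H : lmodType C)
  (dot : {dot H for @Num.conj C}) u v : dot u v = (dot v u)^*.
Proof. by rewrite (hermC dot) expr0 mul1r. Qed.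

Section hilbert.
Context {C : numClosedFieldType} {H : completeNormedModType C}.
Variable dot : {dot H for @Num.conj C}.
Hypothesis norm_dot : forall x : H, `|x| ^+ 2 = dot x x.
Implicit Types (x y z u v w : H) (c : C).

Lemma dotZl c u v : dot (c *: u) v = c * dot u v.
Proof. by rewrite linearZl_LR. Qed.

Lemma dotZr c u v : dot u (c *: v) = c^* * dot u v.
Proof. by rewrite linearZr_LR. Qed.

Lemma sqr_normD u v : `|u + v| ^+ 2 = `|u| ^+ 2 + `|v| ^+ 2 + (dot u v + dot v u).
Proof. by rewrite !norm_dot linearDl !linearDr/= (addrC (dot v u)) addrACA. Qed.

Lemma sqr_normB u v : `|u - v| ^+ 2 = `|u| ^+ 2 + `|v| ^+ 2 - (dot u v + dot v u).
Proof. by rewrite sqr_normD normrN linearNr linearNl opprD. Qed.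

Lemma parallelogram u v :
  `|u + v| ^+ 2 + `|u - v| ^+ 2 = (`|u| ^+ 2 + `|v| ^+ 2) *+ 2.
Proof. by rewrite sqr_normD sqr_normB addrACA subrr addr0 mulr2n. Qed.

(** Pythagoras after removing the component of [u] along [v]. It gives Cauchy-Schwarz, and in
    [dense_add_orthogonal] it measures how much a residual can still be shortened. *)
Lemma projection_norm u v : v != 0 ->
  `|u - (dot u v / `|v| ^+ 2) *: v| ^+ 2 =
  `|u| ^+ 2 - `|dot u v| ^+ 2 / `|v| ^+ 2.
Proof.
move=> v0; have nv0 : `|v| ^+ 2 != 0 by rewrite expf_neq0// normr_eq0.
rewrite sqr_normB dotZl dotZr normrZ exprMn !normCK (dotC dot v u).
rewrite rmorphM/= fmorphV/= rmorphXn/= (CrealP (normr_real v)).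
by field; rewrite -normr_eq0 in v0.
Qed.

Lemma cauchy_schwarz u v : `|dot u v| <= `|u| * `|v|.
Proof.
have [->|v0] := eqVneq v 0; first by rewrite linear0r !normr0 mulr0.
rewrite -(@ler_pXn2r _ 2)// ?nnegrE ?mulr_ge0// exprMn -ler_pdivrMr; last first.
  by rewrite exprn_gt0// normr_gt0.
by rewrite -subr_ge0 -(projection_norm u v0) exprn_ge0.
Qed.

Lemma cvg_dot {T : Type} (F : set_system T) (f g : T -> H) x y : Filter F ->
  f @ F --> x -> g @ F --> y -> (fun t => dot (f t) (g t) : C^o) @ F --> (dot x y : C^o).
Proof.
move=> FF fx gy; apply/cvgrPdist_lt => e e0.
have b0 : (fun t => `|f t - x| * `|g t| + `|x| * `|g t - y|) @ F --> (0 : C).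
  rewrite -[X in _ --> X](_ : `|x - x| * `|y| + `|x| * `|y - y| = 0).
    apply: cvgD; apply: cvgM; try exact: cvg_cst; do ?apply: cvg_norm => //.
      by apply: cvgB => //; exact: cvg_cst.
    by apply: cvgB => //; exact: cvg_cst.
  by rewrite !subrr normr0 mul0r mulr0 addr0.
move/cvgrPdist_lt : b0 => /(_ _ e0); apply: filterS => t.
rewrite sub0r normrN ger0_norm ?addr_ge0 ?mulr_ge0//; apply: le_lt_trans.
have -> : dot x y - dot (f t) (g t) = - (dot (f t - x) (g t) + dot x (g t - y)).
  by rewrite linearBl linearBr/=; ring.
by rewrite normrN (le_trans (ler_normD _ _))// lerD// cauchy_schwarz.
Qed.

Lemma norm_lt_of_sqr (V : normedZmodType C) (v : V) e :
  0 < e -> `|v| ^+ 2 < e ^+ 2 -> `|v| < e.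
Proof. by move=> e0; rewrite ltr_pXn2r ?nnegrE ?normr_ge0 ?ltW. Qed.

Lemma cauchy_norm_cvg {T : Type} (F : set_system T) (f : T -> H) :
  ProperFilter F ->
  (forall e, 0 < e -> exists t, \forall s \near F, `|f t - f s| < e) ->
  exists y, f @ F --> y.
Proof.
move=> PF fc; suff : cvg (f @ F) by move=> cf; exists (lim (f @ F)).
apply/cauchy_cvgP/cauchy_exP => e e0; have [t ft] := fc _ e0.
by exists (f t); move: ft; rewrite -ball_normE.
Qed.

Lemma cvg0_sqr_norm {T : Type} (F : set_system T) (f : T -> H) (b : T -> C) :
  Filter F -> (forall t, `|f t| ^+ 2 <= b t) -> (b : T -> C^o) @ F --> (0 : C^o) ->
  f @ F --> (0 : H).
Proof.
move=> FF fb b0; apply/cvgr0Pnorm_lt => e e0.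
move/cvgr0Pnorm_lt : b0 => /(_ (e ^+ 2) (exprn_gt0 _ e0)); apply: filterS => t.
rewrite ger0_norm ?(le_trans _ (fb t)) ?exprn_ge0// => bt.
by apply: norm_lt_of_sqr => //; exact: le_lt_trans (fb t) bt.
Qed.

End hilbert.

(** * Approximate orthogonal decomposition *)

Section orthogonal_complement.
Context {R : realType} {H : completeNormedModType R[i]}.
Variable dot : {dot H for @Num.conj R[i]}.
Hypothesis norm_dot : forall x : H, `|x| ^+ 2 = dot x x.
Local Notation C := R[i].

Lemma real_complexRe (z : C) : 0 <= z -> ((complex.Re z)%:C)%C = z.
Proof. by move=> z0; rewrite RRe_real ?ger0_real. Qed.

Lemma cvg_natSinv : (fun n => n.+1%:R^-1 : C^o) @ \oo --> (0 : C^o).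
Proof.
apply/cvgr0Pnorm_lt => e e0; have eE := real_complexRe (ltW e0).
have er0 : 0 < complex.Re e by rewrite -ltcR eE.
apply: filterS (near_infty_natSinv_lt (PosNum er0)) => n /=; rewrite -ltcR eE.
by rewrite fmorphV/= rmorph_nat ger0_norm// invr_ge0.
Qed.

(** Suprema and infima live in [R], so the infimum is taken over real parts and cast back to
    [R[i]]. *)
Lemma sqr_dist_inf (W : set H) (x : H) : W !=set0 ->
  exists2 D : C, forall w, W w -> D <= `|x - w| ^+ 2 &
    forall e, 0 < e -> exists2 w, W w & `|x - w| ^+ 2 < D + e.
Proof.
move=> [w0 Ww0].
pose E : set R := [set complex.Re (`|x - w| ^+ 2) | w in W].
have sq0 (w : H) : 0 <= `|x - w| ^+ 2 by rewrite exprn_ge0.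
have hE : has_inf E.
  split; first by exists (complex.Re (`|x - w0| ^+ 2)), w0.
  exists 0 => _ [w Ww <-].
  by have := sq0 w; rewrite lecE => /andP[].
exists ((inf E)%:C)%C.
  move=> w Ww; rewrite -[leRHS]real_complexRe// lecR; apply: ge_inf; first exact: hE.2.
  by exists w.
move=> e e0; have eE := real_complexRe (ltW e0).
have er0 : 0 < complex.Re e by rewrite -ltcR eE.
have [_ [w Ww <-] lt] := inf_adherent er0 hE.
by exists w => //; rewrite -(real_complexRe (sq0 w)) -eE -rmorphD/= ltcR.
Qed.

(** [W] need not be closed, so the projection [y] of [x] lies only in its closure. A minimizing
    sequence [w_] converges to [y] by the parallelogram law, [x - y] is orthogonal to [W], and [y]
    is then replaced by a nearby [w_ N]. *)
Lemma dense_add_orthogonal (W : set H) : W !=set0 ->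
  (forall c u v, W u -> W v -> W (c *: u + v)) ->
  forall x e, 0 < e -> exists w u,
    [/\ W w, forall v, W v -> dot u v = 0 & `|x - (w + u)| < e].
Proof.
move=> W0 WD x e e0; have [D Dle Dlt] := sqr_dist_inf x W0.
have Wv u v c : W u -> W v -> W (u + c *: v).
  by move=> Wu Wv; rewrite addrC; exact: WD.
(* An almost minimal residual is almost orthogonal to [W]: subtracting its component along [v]
   cannot bring the squared length below [D]. *)
have near_ortho e' w v : W w -> `|x - w| ^+ 2 < D + e' -> W v ->
    `|dot (x - w) v| ^+ 2 <= e' * `|v| ^+ 2.
  move=> Ww we Wv'; have [->|v0] := eqVneq v 0.
    by rewrite linear0r !normr0 !expr0n/= mulr0.
  rewrite -ler_pdivrMr ?exprn_gt0 ?normr_gt0//.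
  have := Dle _ (Wv w v (dot (x - w) v / `|v| ^+ 2) Ww Wv').
  rewrite opprD addrA (projection_norm norm_dot)// lerBrDr => le1.
  by have := le_lt_trans le1 we; rewrite ltrD2l => /ltW.
have near_inf e' w w' : W w -> W w' -> `|x - w| ^+ 2 < D + e' ->
    `|x - w'| ^+ 2 < D + e' -> `|w' - w| ^+ 2 <= e' *+ 4.
  move=> Ww Ww' we we'.
  have := parallelogram norm_dot (x - w) (x - w').
  have -> : x - w - (x - w') = w' - w by rewrite opprB addrC addrA subrK.
  have -> : x - w + (x - w') = 2 *: (x - (2^-1 *: w + 2^-1 *: w')).
    rewrite addrACA -opprD scalerBr scalerDr !scalerA divff ?pnatr_eq0// !scale1r.
    by rewrite scaler_nat mulr2n.
  have Wh : W (2^-1 *: w + 2^-1 *: w').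
    apply: Wv => //; rewrite -[_ *: w]addr0.
    have -> : (0 : H) = (-1) *: w + w by rewrite scaleN1r addNr.
    by do 2 apply: (WD) => //.
  have Dm := Dle _ Wh; rewrite normrZ exprMn ger0_norm// => eqn.
  have -> : `|w' - w| ^+ 2 = (`|x - w| ^+ 2 + `|x - w'| ^+ 2) *+ 2
    - 2 ^+ 2 * `|x - (2^-1 *: w + 2^-1 *: w')| ^+ 2 by rewrite -eqn; ring.
  have -> : e' *+ 4 = (D + e' + (D + e')) *+ 2 - 2 ^+ 2 * D by ring.
  apply: lerD; first by rewrite ler_pMn2r// lerD// ltW.
  by rewrite lerN2 ler_wpM2l// exprn_ge0.
have pos n : 0 < n.+1%:R^-1 :> C by rewrite invr_gt0 ltr0n.
have /choice[w_ w_P] n : exists w, W w /\ `|x - w| ^+ 2 < D + n.+1%:R^-1.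
  by have [w Ww lt] := Dlt _ (pos n); exists w.
have inv0 : (fun n => n.+1%:R^-1 : C^o) @ \oo --> (0 : C^o).
  exact: cvg_natSinv.
have [y wy] : exists y : H, w_ @ \oo --> y.
  apply: cauchy_norm_cvg => e' e'0.
  (* [near_inf] multiplies the excess by 4, which leaves [e' ^+ 2 / 2], strictly below [e' ^+ 2]. *)
  have e2 : 0 < e' ^+ 2 / 8 by rewrite divr_gt0// exprn_gt0.
  have [N _ HN] := (cvgr0Pnorm_lt _).1 inv0 _ e2.
  exists N; near=> n.
  apply: (norm_lt_of_sqr e'0).
  have lt4 m : (N <= m)%N -> `|x - w_ m| ^+ 2 < D + e' ^+ 2 / 8.
    move=> Nm; apply: (lt_trans (w_P m).2); rewrite ltrD2l.
    by have := HN _ Nm; rewrite ger0_norm// ltW.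
  have Nn : (N <= n)%N by near: n; exact: nbhs_infty_ge.
  have := near_inf _ _ _ (w_P n).1 (w_P N).1 (lt4 _ Nn) (lt4 _ (leqnn _)).
  move/le_lt_trans; apply; rewrite -[_ *+ 4]mulr_natr mulrAC -mulrA gtr_pMr ?exprn_gt0//.
  by rewrite ltr_pdivrMr// mul1r ltr_nat.
have xy v : W v -> dot (x - y) v = 0.
  move=> Wv'; have c1 : (fun n => dot (x - w_ n) v : C^o) @ \oo --> (dot (x - y) v : C^o).
    by apply: (cvg_dot norm_dot); [apply: cvgB => //|]; exact: cvg_cst.
  have c2 : (fun n => dot (x - w_ n) v : C^o) @ \oo --> (0 : C^o).
    apply/cvgr0Pnorm_lt => e' e'0.
    have vp : 0 < `|v| ^+ 2 + 1 by rewrite ltr_wpDl// exprn_ge0.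
    have e2 : 0 < e' ^+ 2 / (`|v| ^+ 2 + 1) by rewrite divr_gt0// exprn_gt0.
    apply: filterS ((cvgr0Pnorm_lt _).1 inv0 _ e2) => n.
    rewrite ger0_norm// ltr_pdivlMr// => lte.
    rewrite -(@ltr_pXn2r _ 2) ?nnegrE ?normr_ge0 ?(ltW e'0)//; apply: le_lt_trans lte.
    apply: le_trans (near_ortho _ _ _ (w_P n).1 (w_P n).2 Wv') _.
    by rewrite ler_wpM2l// lerDl.
  exact: (cvg_unique (@norm_hausdorff _ C^o) c1 c2).
have [N _ HN] := (cvgrPdist_lt _ _).1 wy _ e0.
exists (w_ N), (x - y); split; [exact: (w_P N).1 | exact: xy |].
rewrite addrCA opprD addrA subrr add0r opprB.
exact: HN (leqnn N).
Unshelve. all: by end_near. Qed.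

End orthogonal_complement.

(** * Realization of positive semidefinite kernels *)

Section gram.
Context {C : numClosedFieldType} {H : normedModType C}.
Variable dot : {dot H for @Num.conj C}.
Hypothesis infH : ~ finite_dimensional H.

Lemma dot_suml n (c : 'I_n -> C) (f : 'I_n -> H) v :
  dot (\sum_i c i *: f i) v = \sum_i c i * dot (f i) v.
Proof. by rewrite linear_sumlz; apply: eq_bigr => i _; rewrite linearZl_LR. Qed.

Lemma dot_sumr n (c : 'I_n -> C) (f : 'I_n -> H) v :
  dot v (\sum_i c i *: f i) = \sum_i (c i)^* * dot v (f i).
Proof. by rewrite linear_sumr; apply: eq_bigr => i _; rewrite linearZr_LR. Qed.

(** The [f i] may be dependent, so [b] has to respect their linear relations. This suffices: a
    vector killed by the Gram matrix gives, after conjugation, a combination of the [f i] of norm 0,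
    hence a relation; so [b] annihilates the cokernel of the Gram matrix and lies in its row
    space. *)
Lemma gram_solve n (f : 'I_n -> H) (b : 'I_n -> C) :
  (forall c : 'I_n -> C, \sum_i c i *: f i = 0 -> \sum_i (c i)^* * b i = 0) ->
  exists a : 'I_n -> C, forall j, dot (\sum_i a i *: f i) (f j) = b j.
Proof.
move=> bP; pose G : 'M[C]_n := \matrix_(i, j) dot (f i) (f j).
have : ((\row_j b j) <= G)%MS.
  rewrite submxE; move: (cokermx G) (mulmx_coker G) => K GK0.
  apply/eqP/matrixP => i0 j; rewrite !mxE; pose v i := (K i j)^*.
  suff z0 : \sum_i v i *: f i = 0.
    rewrite -[RHS](bP _ z0); apply: eq_bigr => i _.
    by rewrite !mxE /v conjCK mulrC.
  apply/eqP; rewrite -(dnorm_eq0 dot) {1}dot_suml big1// => i _.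
  rewrite dot_sumr; have /matrixP/(_ i j) := GK0; rewrite !mxE => GK.
  rewrite (_ : \sum_ _ _ = 0) ?mulr0// -[RHS]GK; apply: eq_bigr => l _.
  by rewrite !mxE /v conjCK mulrC.
move=> /submxP[A AG]; exists (fun i => A 0 i) => j; rewrite dot_suml.
move/matrixP : AG => /(_ 0 j); rewrite !mxE => ->.
by apply: eq_bigr => i _; rewrite !mxE.
Qed.

(** Infinite dimension provides a vector outside the span; subtract its projection and normalize. *)
Lemma orthogonal_unit n (f : 'I_n -> H) :
  exists2 e, dot e e = 1 & forall j, dot e (f j) = 0.
Proof.
have [x xf] : exists x, ~ exists c : 'I_n -> C, x = \sum_i c i *: f i.
  by apply/existsNP => fx; apply: infH; exists n, f.
have [c f0|a aP] := @gram_solve n f (fun i => dot x (f i)).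
  by rewrite -dot_sumr f0 linear0r.
pose u := x - \sum_i a i *: f i.
have u0 : u != 0 by rewrite subr_eq0; apply/eqP => xE; apply: xf; exists a.
have uu : 0 < dot u u by rewrite dnorm_gt0.
have s0 : sqrtC (dot u u) != 0 by rewrite sqrtC_eq0 gt_eqF.
exists ((sqrtC (dot u u))^-1 *: u) => [|j].
  rewrite linearZl_LR linearZr_LR/= mulrA fmorphV/= geC0_conj ?sqrtC_ge0 ?ltW//.
  by rewrite -invfM -expr2 sqrtCK mulVf ?gt_eqF.
have uf : dot u (f j) = 0 by rewrite linearBl/= aP subrr.
by rewrite linearZl_LR/= uf mulr0.
Qed.

(** The hypothesis says that the Gram form bordered by [b] and [r] is positive semidefinite. The new
    vector is the element [w] of the span with the prescribed inner products, plus a multiple of a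
    unit vector orthogonal to the span that corrects the length. *)
Lemma gram_extend n (f : 'I_n -> H) (b : 'I_n -> C) (r : C) :
  (forall (c : 'I_n -> C) d, let z := \sum_i c i *: f i in
    let s := d * \sum_i (c i)^* * b i in 0 <= dot z z + (s + s^*) + d * d^* * r) ->
  exists2 h, dot h h = r & forall j, dot h (f j) = b j.
Proof.
move=> pos.
have r0 : 0 <= r.
  have := pos (fun=> 0) 1; rewrite /= !big1 => [|i _|i _].
  - by rewrite linear0l mulr0 conjC0 conjC1 !addr0 add0r !mul1r.
  - by rewrite conjC0 mul0r.
  - by rewrite scale0r.
have [c f0|a aP] := @gram_solve n f b.
  set t := \sum_i _; have r1 : 0 < r + 1 by rewrite ltr_wpDl.
  (* On a relation among the [f i] this choice makes the form equal to minus
     [|t|^2 (r + 2) / (r + 1)^2], forcing [t = 0]. The denominator is [r + 1] because [r] may be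
     0. *)
  have := pos c (- (t^* / (r + 1))); rewrite /= f0 linear0l add0r -/t.
  rewrite !(rmorphN, rmorphM, conjCK, fmorphV)/= rmorphD/= conjC1 (geC0_conj r0).
  rewrite [X in 0 <= X](_ : _ = - ((t * t^*) * ((r + 2) / (r + 1) ^+ 2)));
    last by rewrite conjCK; field; rewrite gt_eqF.
  rewrite oppr_ge0 pmulr_lle0; last by rewrite divr_gt0 ?exprn_gt0// ltr_wpDl.
  move=> t0; apply/eqP; rewrite -normr_eq0 -sqrf_eq0 normCK.
  by rewrite eq_le t0 mul_conjC_ge0.
set w := \sum_i _ in aP.
have [e e1 eP] := orthogonal_unit f.
have wa : \sum_i (a i)^* * b i = dot w w.
  by rewrite {2}/w dot_sumr; apply: eq_bigr => i _; rewrite aP.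
(* The bordered form at [(a, -1)] is exactly this difference. *)
have rw : 0 <= r - dot w w.
  have := pos a (- 1); rewrite /= -/w wa.
  rewrite [X in 0 <= X](_ : _ = r - dot w w)//.
  by rewrite rmorphM/= rmorphN/= conjC1 (geC0_conj (dnorm_ge0 _ _)); ring.
have ew : dot e w = 0 by rewrite dot_sumr big1// => i _; rewrite eP mulr0.
have we : dot w e = 0 by rewrite (dotC dot) ew conjC0.
exists (w + sqrtC (r - dot w w) *: e) => [|j].
  rewrite linearDl/= !linearDr/= linearZl_LR !linearZr_LR/= linearZl_LR/= ew we.
  rewrite !mulr0 e1 mulr1 addr0 add0r geC0_conj ?sqrtC_ge0//.
  by rewrite -expr2 sqrtCK addrC subrK.
by rewrite linearDl/= linearZl_LR/= eP mulr0 addr0 aP.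
Qed.

Lemma gram_realization (k : nat -> nat -> C) (m : nat) (s : nat -> H) :
  (forall i j, k i j = (k j i)^*) ->
  (forall n (c : nat -> C), 0 <= \sum_(i < n) \sum_(j < n) c i * (c j)^* * k i j) ->
  (forall i j, (i < m)%N -> (j < m)%N -> dot (s i) (s j) = k i j) ->
  exists2 h : nat -> H, forall i j, dot (h i) (h j) = k i j &
    forall i, (i < m)%N -> h i = s i.
Proof.
move=> kC kpos sk.
(* The correctness of the earlier vectors is a premise inside the existential, so that choice yields
   a total function [g]; the recursion then runs over the list [L n] of vectors already built. *)
have step n (f : nat -> H) : exists v,
    (forall i j, (i < n)%N -> (j < n)%N -> dot (f i) (f j) = k i j) ->
    dot v v = k n n /\ forall j, (j < n)%N -> dot v (f j) = k n j.
  have [fk|nfk] := pselect (forall i j, (i < n)%N -> (j < n)%N ->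
    dot (f i) (f j) = k i j); last by exists 0.
  have [c d /=|v vv vP] :=
      @gram_extend n (fun i : 'I_n => f i) (fun i : 'I_n => k n i) (k n n).
    set z := \sum_i _; set t := d * _.
    pose c' i := if insub i is Some i' then c i' else d.
    have cE (i : 'I_n) : c' i = c i by rewrite /c' valK.
    have cn : c' n = d by rewrite /c' insubF// ltnn.
    rewrite [X in 0 <= X](_ : _ = \sum_(i < n.+1) \sum_(j < n.+1)
      c' i * (c' j)^* * k i j) ?kpos//.
    rewrite big_ord_recr/=; under [X in _ = X + _]eq_bigr do rewrite big_ord_recr/=.
    rewrite big_split/= big_ord_recr/= cn [RHS]addrA; congr (_ + _).
    have -> : \sum_(i < n) c' i * d^* * k i n = t^*.
      rewrite /t mulr_sumr rmorph_sum; apply: eq_bigr => j _.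
      by rewrite cE !rmorphM/= conjCK -kC mulrA [c j * _]mulrC.
    have -> : \sum_(j < n) d * (c' j)^* * k n j = t.
      by rewrite /t mulr_sumr; apply: eq_bigr => j _; rewrite cE mulrA.
    rewrite -addrA [t^* + t]addrC; congr (_ + _).
    rewrite /z dot_suml; apply: eq_bigr => i _; rewrite dot_sumr mulr_sumr.
    by apply: eq_bigr => j _; rewrite fk// !cE mulrA.
  by exists v => _; split => // j jn; exact: (vP (Ordinal jn)).
have /choice[g gP] (nf : nat * (nat -> H)) := step nf.1 nf.2.
pose next n (l : seq H) := if (n < m)%N then s n else g (n, nth 0 l).
pose L := fix L n := if n is n'.+1 then rcons (L n') (next n' (L n')) else [::].
have szL n : size (L n) = n by elim: n => //= n IH; rewrite size_rcons IH.
pose h n := next n (L n).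
have nthL n i : (i < n)%N -> nth 0 (L n) i = h i.
  elim: n => //= n IH; rewrite ltnS leq_eqVlt nth_rcons szL => /predU1P[->|lin].
    by rewrite ltnn eqxx.
  by rewrite lin IH.
have hs i : (i < m)%N -> h i = s i by move=> im; rewrite /h /next im.
exists h => //.
suff hk n : forall i j, (i < n)%N -> (j < n)%N -> dot (h i) (h j) = k i j.
  by move=> i j; apply: (hk (maxn i j).+1); rewrite ltnS ?leq_maxl ?leq_maxr.
elim: n => // n IH.
have [hnn hn] : dot (h n) (h n) = k n n /\ forall j, (j < n)%N -> dot (h n) (h j) = k n j.
  have [nm|mn] := ltnP n m.
    by split => [|j jn]; rewrite !hs// ?sk// (ltn_trans jn).
  have [i j ni nj|] := gP (n, nth 0 (L n)); first by rewrite /= !nthL// IH.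
  have <- : h n = g (n, nth 0 (L n)) by rewrite {1}/h /next ltnNge mn.
  by move=> /= hnn hn; split=> // j jn; rewrite -(nthL n j jn) hn.
move=> i j; rewrite !ltnS leq_eqVlt => /predU1P[->|lin];
  rewrite leq_eqVlt => /predU1P[->|ljn] //; first exact: hn.
  by rewrite (dotC dot) hn// -kC.
exact: IH.
Qed.

End gram.

(** * Time axes *)

(* [tsub] is subtraction truncated at [0], with respect to the order [tle]. *)
Record time_axis (M : TopologicalNmodule.type) := TimeAxis {
  tsub : M -> M -> M;
  tle : rel M;
  tsub_continuous : continuous (fun p : M * M => tsub p.1 p.2);
  tsubDl : forall r s t, tsub (r + s) (r + t) = tsub s t;
  tsubr0 : forall t, tsub t 0 = t;
  tle_total : total tle;
  tle_trans : transitive tle;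
  tle0 : forall t, tle 0 t;
  tsub_eq0 : forall s t, tle s t -> tsub s t = 0;
  tsub_add : forall s t u, tle s t -> tle t u -> tsub u s = tsub t s + tsub u t;
  tdense : nat -> M;
  tdenseP : forall t : M, exists u : nat -> nat, (fun n => tdense (u n)) @ \oo --> t;
  texh : nat -> set M;
  texh_compact : forall n, compact (texh n);
  texh_mono : forall m n, (m <= n)%N -> texh m `<=` texh n;
  texh_nbhs : forall t : M, exists n, nbhs t (texh n) }.

Section real_axis.
Variable R : realType.
Local Notation rplus := (rplus R).

Lemma max0_ge0 (x : R) : 0 <= Num.max x 0. Proof. by rewrite le_max lexx orbT. Qed.

Definition rplus_of (x : R) : rplus := RPlus (max0_ge0 x).

Definition rplusB (s t : rplus) : rplus := rplus_of (rval s - rval t).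

Lemma rval_continuous : continuous (@rval R : rplus -> R).
Proof. exact: initial_continuous. Qed.

Lemma rplus_of_continuous : continuous rplus_of.
Proof.
apply: continuous_comp_initial => x.
apply: (@continuous_max _ _ (fun x : R => x) (fun=> 0)); [exact: cvg_id|exact: cvg_cst].
Qed.

Lemma rplusB_continuous : continuous (fun p : rplus * rplus => rplusB p.1 p.2).
Proof.
move=> [s t]; apply: (@continuous_comp _ _ _ (fun p : rplus * rplus => rval p.1 - rval p.2) rplus_of).
  apply: (@cvgB _ R^o); apply: continuous_comp; do ?exact: rval_continuous.
    exact: cvg_fst.
  exact: cvg_snd.
exact: rplus_of_continuous.
Qed.

Definition rplus_rat (n : nat) : rplus :=
  rplus_of (if unpickle n is Some (a, b) then a%:R / b.+1%:R else 0).

Lemma rplus_denseP (t : rplus) : exists u : nat -> nat,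
  (fun n => rplus_rat (u n)) @ \oo --> t.
Proof.
(* The approximants are [floor(t (n+1)) / (n+1)], within [1/(n+1)] of [t]. *)
exists (fun n => pickle (Num.truncn (rval t * n.+1%:R), n)).
apply/initial_cvgP.
suff : (fun n => Num.max ((Num.truncn (rval t * n.+1%:R))%:R / n.+1%:R) 0)
    @ \oo --> rval t.
  have E : (fun n => Num.max ((Num.truncn (rval t * n.+1%:R))%:R / n.+1%:R) 0) =
      (fun n => rval (rplus_rat (pickle (Num.truncn (rval t * n.+1%:R), n)))).
    by apply/funext => n; rewrite /rplus_rat pickleK.
  by rewrite E.
apply/(@cvgrPdist_lt _ R^o) => e e0; near=> n.
have n0 : 0 < n.+1%:R :> R by rewrite ltr0n.
have /andP[le lt] := truncn_itv (mulr_ge0 (rval_ge0 t) (ltW n0)).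
rewrite max_l; last by rewrite divr_ge0.
rewrite ger0_norm ?subr_ge0 ?ler_pdivrMr// ltrBlDr.
apply: (@lt_trans _ _ (n.+1%:R^-1 + (Num.truncn (rval t * n.+1%:R))%:R / n.+1%:R)).
  by rewrite -[X in X + _]mul1r -mulrDl ltr_pdivlMr// nat1r.
by rewrite ltrD2r; near: n; exact: (near_infty_natSinv_lt (PosNum e0)).
Unshelve. all: by end_near. Qed.

Lemma rplus_compact n : compact [set t : rplus | rval t <= n%:R].
Proof.
have -> : [set t : rplus | rval t <= n%:R] = rplus_of @` [set` `[0, n%:R]%R].
  apply/seteqP; split => [t /= tn|_ /= [x + <-]].
    exists (rval t); first by rewrite in_itv/= rval_ge0.
    by apply: val_inj; rewrite /= max_l ?rval_ge0.
  by rewrite in_itv/= ge_max => /andP[_ ->]; rewrite ler0n.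
apply: continuous_compact; last exact: segment_compact.
by apply: continuous_subspaceT; exact: rplus_of_continuous.
Qed.

Lemma rplus_nbhs_exh (t : rplus) :
  exists n, nbhs t [set t : rplus | rval t <= n%:R].
Proof.
exists (Num.truncn (rval t)).+1.
have : nbhs (rval t) [set x : R | x <= (Num.truncn (rval t)).+1%:R].
  by apply: lt_le_nbhsl; exact: truncnS_gt.
exact: rval_continuous.
Qed.

Lemma rplus_time_axis : time_axis (rplus : TopologicalNmodule.type).
Proof.
apply: (@TimeAxis _ rplusB (fun s t => rval s <= rval t) rplusB_continuous
  _ _ _ _ _ _ _ rplus_rat rplus_denseP _ rplus_compact _ rplus_nbhs_exh).
- by move=> r s t; apply: val_inj => /=; congr Num.max; ring.
- by move=> t; apply: val_inj; rewrite /= subr0 max_l ?rval_ge0.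
- by move=> s t; exact: le_total.
- by move=> s t u; exact: le_trans.
- exact: rval_ge0.
- by move=> s t st; apply: val_inj; rewrite /= max_r// subr_le0.
- move=> s t u st tu; apply: val_inj; rewrite /= !max_l ?subr_ge0//; last exact: le_trans tu.
  ring.
- by move=> m n mn t /= /le_trans; apply; rewrite ler_nat.
Qed.

End real_axis.

Lemma nat_time_axis : time_axis (nat : TopologicalNmodule.type).
Proof.
have nc : continuous (fun p : nat * nat => (p.1 - p.2)%N).
  move=> [m n] A /principal_filterP mnA.
  exists ([set m], [set n]) => /=; first by split; exact/principal_filterP.
  by move=> [i j] /= [-> ->].
have nd (t : nat) : exists u : nat -> nat, (fun n => u n) @ \oo --> t.
  by exists (fun=> t); exact: cvg_cst.
have ncpt n : compact [set t : nat | (t <= n)%N].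
  by apply: finite_compact; exact: (finite_II n.+1).
have nn (t : nat) : exists n, nbhs t [set t : nat | (t <= n)%N].
  by exists t; apply/principal_filterP => /=.
apply: (@TimeAxis _ subn leq nc _ _ _ _ _ _ _ id nd _ ncpt _ nn).
- by move=> r s t; rewrite -[LHS]/(_ - _)%N subnDl.
- exact: subn0.
- exact: leq_total.
- by move=> s t u; exact: leq_trans.
- by [].
- by move=> s t /eqP.
- by move=> s t u st tu; rewrite -[RHS]/(_ + _)%N; rewrite addnC addnBA ?subnK.
- by move=> m n mn t /= /leq_trans; apply.
Qed.

(** * The dilation kernel *)

Section contractions.
Context {R : realType} {H : completeNormedModType R[i]}.
Implicit Types A : H -> H.

Lemma contraction_le A (x : H) : Defs.contraction A -> `|A x| <= `|x|.
Proof.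
move=> [lA]; have A0 : A 0 = 0 by have := lA (-1) 0 0; rewrite !scaleN1r !addNr.
have [->|x0 A1] := eqVneq x 0; first by rewrite A0 normr0.
have nx : 0 < `|x| by rewrite normr_gt0.
have Ax : A (`|x|^-1 *: x) = `|x|^-1 *: A x.
  by rewrite -[_ *: x]addr0 lA A0 addr0.
rewrite -[leRHS]mulr1 -ler_pdivrMl// -[leLHS](_ : `|A (`|x|^-1 *: x)| = _); last first.
  by rewrite Ax normrZ ger0_norm// invr_ge0.
have := le_trans (@ereal_sup_ubound _ _ (complex.Re `|A (`|x|^-1 *: x)|)%:E _) A1.
rewrite lee_fin -lecR real_complexRe//; apply.
exists (`|x|^-1 *: x) => //=.
by rewrite normrZ ger0_norm ?invr_ge0// mulVf// gt_eqF.
Qed.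

Lemma le_contraction A : linear A -> (forall x : H, `|A x| <= `|x|) -> Defs.contraction A.
Proof.
move=> lA A1; split => //; apply: ge_ereal_sup => _ [x /= x1 <-].
by rewrite lee_fin -lecR real_complexRe// (le_trans (A1 x)).
Qed.

End contractions.

Section dilation_kernel.
Context {R : realType} {H : completeNormedModType R[i]}.
Variable dot : {dot H for @Num.conj R[i]}.
Hypothesis norm_dot : forall x : H, `|x| ^+ 2 = dot x x.
Context {M : TopologicalNmodule.type}.
Variables (ax : time_axis M) (T : M -> H -> H).
Hypothesis sgT : contractive_semigroup H M T.
Local Notation C := R[i].
Local Notation "t ∸ s" := (tsub ax t s) (at level 50).

Lemma semigroup_linear t : linear (T t).
Proof. by have [/(_ t)[]] := sgT. Qed.

Lemma semigroup_le t x : `|T t x| <= `|x|.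
Proof. by have [/(_ t) cT] := sgT; move=> _ _ _; exact: contraction_le. Qed.

Lemma semigroup0 x : T 0 x = x.
Proof. by have [_ _ ->] := sgT. Qed.

Lemma semigroupD s t x : T (s + t) x = T s (T t x).
Proof. by have [_ _ _ ->] := sgT. Qed.

Lemma semigroup_add t x y : T t (x + y) = T t x + T t y.
Proof. by have := semigroup_linear t 1 x y; rewrite !scale1r. Qed.

Lemma semigroup_zero t : T t 0 = 0.
Proof. by have := semigroup_linear t (-1) 0 0; rewrite !scaleN1r !addNr. Qed.

Lemma semigroup_scale t c x : T t (c *: x) = c *: T t x.
Proof. by have := semigroup_linear t c x 0; rewrite semigroup_zero !addr0. Qed.

Lemma semigroup_sum t I (l : seq I) (f : I -> H) :
  T t (\sum_(i <- l) f i) = \sum_(i <- l) T t (f i).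
Proof. exact: (big_morph _ (semigroup_add t) (semigroup_zero t)). Qed.

(* One of the two truncated differences is [0], so this is [<T(t-s)x, y>] if *)
(* [t >= s] and [<x, T(s-t)y>] if [t <= s].                                 *)
Definition dil_ker (p q : M * H) : C :=
  dot (T (p.1 ∸ q.1) p.2) (T (q.1 ∸ p.1) q.2).

Lemma dil_kerC p q : dil_ker p q = (dil_ker q p)^*.
Proof. exact: dotC. Qed.

Lemma tsubrr t : t ∸ t = 0.
Proof. by apply: tsub_eq0; have := tle_total ax t t; rewrite orbb. Qed.

(* Adding an earlier point [(t1, x1)] completes a square: the form grows by  *)
(* [|x1 + Y|^2 - |Y|^2], and moving the base time back to [t0] contracts.    *)
Lemma dil_ker_ge0_sorted (l : seq (M * H)) t0 :
  sorted (fun p q => tle ax p.1 q.1) l -> all (fun p => tle ax t0 p.1) l ->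
  `|\sum_(p <- l) T (p.1 ∸ t0) p.2| ^+ 2 <=
    \sum_(p <- l) \sum_(q <- l) dil_ker p q.
Proof.
elim: l t0 => [|p l IH] t0 sl; first by rewrite !big_nil normr0 expr0n.
move=> /= /andP[t0p t0l].
have pl : all (fun q => tle ax p.1 q.1) l.
  by apply: order_path_min sl => a b c; exact: tle_trans.
set Y := \sum_(q <- l) T (q.1 ∸ p.1) q.2.
have -> : \sum_(q <- p :: l) T (q.1 ∸ t0) q.2 = T (p.1 ∸ t0) (p.2 + Y).
  rewrite big_cons semigroup_add semigroup_sum; congr (_ + _).
  apply: eq_big_seq => q ql; rewrite -semigroupD -tsub_add//.
  exact: (allP pl).
apply: (@le_trans _ _ (`|p.2 + Y| ^+ 2)).
  by rewrite lerXn2r ?nnegrE// semigroup_le.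
rewrite (sqr_normD norm_dot) big_cons.
under [X in _ <= _ + X]eq_bigr do rewrite big_cons.
rewrite big_split/= big_cons {1}/dil_ker tsubrr !semigroup0 -norm_dot.
have -> : \sum_(q <- l) dil_ker p q = dot p.2 Y.
  rewrite /Y linear_sumr; apply: eq_big_seq => q ql.
  by rewrite /dil_ker (tsub_eq0 (allP pl _ ql)) semigroup0.
have -> : \sum_(q <- l) dil_ker q p = dot Y p.2.
  rewrite /Y linear_sumlz; apply: eq_big_seq => q ql.
  by rewrite /dil_ker (tsub_eq0 (allP pl _ ql)) semigroup0.
have := IH p.1 (path_sorted sl) pl; rewrite -/Y.
set Q := \sum_(i <- l) _ => YQ.
rewrite -subr_ge0 [X in 0 <= X](_ : _ = Q - `|Y| ^+ 2) ?subr_ge0//.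
by ring.
Qed.

(** The double sum does not depend on the order of [l], so [l] may be sorted by time, with base time
    0. Scalar coefficients are absent because [dil_kerZ] absorbs them into the vectors. *)
Lemma dil_ker_ge0 (l : seq (M * H)) : 0 <= \sum_(p <- l) \sum_(q <- l) dil_ker p q.
Proof.
pose r := fun p q : M * H => tle ax p.1 q.1.
have pl : perm_eq l (sort r l) by rewrite perm_sym perm_sort.
rewrite (perm_big _ pl)/=; under eq_bigr do rewrite (perm_big _ pl)/=.
apply: le_trans (dil_ker_ge0_sorted (t0 := 0) _ _); first exact: exprn_ge0.
  by apply: sort_sorted => p q; exact: tle_total.
by apply/allP => p _; exact: tle0.
Qed.

Lemma dil_kerZ t s x y c d :
  dil_ker (t, c *: x) (s, d *: y) = c * d^* * dil_ker (t, x) (s, y).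
Proof.
by rewrite /dil_ker/= !semigroup_scale linearZl_LR linearZr_LR/= mulrA.
Qed.

Lemma dil_kerDl r s t x y : dil_ker (r + s, x) (r + t, y) = dil_ker (s, x) (t, y).
Proof. by rewrite /dil_ker/= !tsubDl. Qed.

Lemma dil_ker_diag t x : dil_ker (t, x) (t, x) = `|x| ^+ 2.
Proof. by rewrite /dil_ker/= tsubrr !semigroup0 norm_dot. Qed.

Lemma dil_ker0 t x y : dil_ker (t, x) (0, y) = dot (T t x) y.
Proof. by rewrite /dil_ker/= tsubr0 (tsub_eq0 (tle0 ax t)) semigroup0. Qed.

Lemma dil_ker_continuous x y :
  continuous (fun p : M * M => dil_ker (p.1, x) (p.2, y) : C^o).
Proof.
have sot z : continuous (T ^~ z) by have [_ + _ _] := sgT; apply.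
move=> p; apply: (cvg_dot norm_dot).
  apply: (@continuous_comp _ _ _ (fun p => p.1 ∸ p.2) (T ^~ x)).
    exact: tsub_continuous.
  exact: sot.
apply: (@continuous_comp _ _ _ (fun p => p.2 ∸ p.1) (T ^~ y)); last exact: sot.
apply: (@continuous_comp _ _ _ (fun p => (p.2, p.1)) (fun p => p.1 ∸ p.2)).
  by apply: cvg_pair; [exact: cvg_snd|exact: cvg_fst].
exact: tsub_continuous.
Qed.

End dilation_kernel.

(** * Semigroups from translation-invariant families *)

Lemma split_third (K : numFieldType) (e : K) : e = e / 3 + e / 3 + e / 3.
Proof. by field. Qed.

Section isometric_extension.
Context {R : realType} {H : completeNormedModType R[i]}.
Variable dot : {dot H for @Num.conj R[i]}.
Hypothesis norm_dot : forall x : H, `|x| ^+ 2 = dot x x.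
Local Notation C := R[i].

(** A formal combination is a list, so that the same one can be evaluated on two families [f] and
    [g] without asking whether either is independent. *)
Definition lincomb {A : Type} (f : A -> H) (l : seq (C * A)) : H :=
  \sum_(p <- l) p.1 *: f p.2.

Lemma lincomb_cat A (f : A -> H) l1 l2 :
  lincomb f (l1 ++ l2) = lincomb f l1 + lincomb f l2.
Proof. exact: big_cat. Qed.

Lemma lincomb_scale A (f : A -> H) c l :
  lincomb f [seq (c * p.1, p.2) | p <- l] = c *: lincomb f l.
Proof.
by rewrite /lincomb big_map scaler_sumr; apply: eq_bigr => p _; rewrite scalerA.
Qed.

Lemma lincombP A (f : A -> H) c l1 l2 :
  lincomb f ([seq (c * p.1, p.2) | p <- l1] ++ l2) =
  c *: lincomb f l1 + lincomb f l2.
Proof. by rewrite lincomb_cat lincomb_scale. Qed.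

Lemma norm_lincomb A (f g : A -> H) :
  (forall a b, dot (f a) (f b) = dot (g a) (g b)) ->
  forall l, `|lincomb f l| = `|lincomb g l|.
Proof.
move=> fg l; have sq (h : A -> H) : `|lincomb h l| ^+ 2 =
    \sum_(p <- l) \sum_(q <- l) p.1 * (q.1^* * dot (h p.2) (h q.2)).
  rewrite norm_dot /lincomb linear_sumlz; apply: eq_bigr => p _.
  rewrite linear_sumr; apply: eq_bigr => q _.
  by rewrite linearZl_LR linearZr_LR.
apply/eqP; rewrite -(@eqrXn2 _ 2)//; apply/eqP; rewrite !sq.
by apply: eq_bigr => p _; apply: eq_bigr => q _; rewrite fg.
Qed.

Lemma norm_lincombB A (f g : A -> H) :
  (forall a b, dot (f a) (f b) = dot (g a) (g b)) ->
  forall l1 l2, `|lincomb f l1 - lincomb f l2| = `|lincomb g l1 - lincomb g l2|.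
Proof.
move=> fg l1 l2; have E (h : A -> H) : lincomb h l1 - lincomb h l2 =
    lincomb h ([seq (-1 * p.1, p.2) | p <- l2] ++ l1).
  by rewrite lincombP scaleN1r addrC.
rewrite !E.
exact: norm_lincomb.
Qed.

Section dense_family.
Context {A : Type}.
Variable f : A -> H.
Hypothesis f_dense : forall x e, 0 < e -> exists l, `|x - lincomb f l| < e.

Lemma eq_dense_lincomb (U V : H -> H) : linear U -> linear V ->
  (forall x, `|U x| <= `|x|) -> (forall x, `|V x| <= `|x|) ->
  (forall a, U (f a) = V (f a)) -> U =1 V.
Proof.
move=> lU lV U1 V1 UV x.
have lin0 (W : H -> H) : linear W -> W 0 = 0.
  by move=> lW; have := lW (-1) 0 0; rewrite !scaleN1r !addNr.
have linB (W : H -> H) : linear W -> forall u v, W (u - v) = W u - W v.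
  by move=> lW u v; rewrite addrC -scaleN1r lW scaleN1r addrC.
have UVl l : U (lincomb f l) = V (lincomb f l).
  rewrite /lincomb; elim: l => [|p l IH]; first by rewrite !big_nil !lin0.
  by rewrite !big_cons lU lV UV IH.
apply/eqP; rewrite -subr_eq0 -normr_le0; apply/ler_addgt0Pr => e e0.
have [l xl] := f_dense x (divr_gt0 e0 (ltr0n C 2)).
rewrite add0r (splitr e).
have -> : U x - V x = U (x - lincomb f l) - V (x - lincomb f l).
  by rewrite (linB U lU) (linB V lV) UVl opprB addrA subrK.
by rewrite (le_trans (ler_normB _ _))// lerD// (le_trans _ (ltW xl)).
Qed.

(** The graph of [V] is the closure [ext] of the pairs [(lincomb f l, lincomb g l)]. Equal Gram
    kernels make these pairs equal in norm, so [ext] preserves norms and is single-valued; density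
    of the combinations of [f] and completeness make it total. *)
Lemma isometric_extension (g : A -> H) :
  (forall a b, dot (f a) (f b) = dot (g a) (g b)) ->
  exists V : H -> H, [/\ linear V, forall x, `|V x| = `|x| & forall a, V (f a) = g a].
Proof.
move=> fg; pose ext x y := forall e, 0 < e -> exists l,
  `|x - lincomb f l| < e /\ `|y - lincomb g l| < e.
have ext_lin c x y x' y' : ext x y -> ext x' y' -> ext (c *: x + x') (c *: y + y').
  move=> xy xy' e e0; have e20 : 0 < e / 2 by rewrite divr_gt0.
  have c0 : 0 < `|c| + 1 by rewrite ltr_wpDl.
  have [l [xl yl]] := xy _ (divr_gt0 e20 c0).
  have [l' [xl' yl']] := xy' _ e20.
  exists ([seq (c * p.1, p.2) | p <- l] ++ l'); rewrite !lincombP.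
  have aux (u u' v v' : H) : `|u - v| < e / 2 / (`|c| + 1) -> `|u' - v'| < e / 2 ->
      `|c *: u + u' - (c *: v + v')| < e.
    move=> uv uv'; rewrite opprD addrACA -scalerBr (splitr e).
    rewrite (le_lt_trans (ler_normD _ _))// ler_ltD// normrZ.
    rewrite (@le_trans _ _ ((`|c| + 1) * `|u - v|)) ?ler_wpM2r ?lerDl//.
    by rewrite mulrC -ler_pdivlMr// ltW.
  by split; exact: aux.
have ext_norm x y : ext x y -> `|y| = `|x|.
  have aux (u v u' v' : H) e : `|u - u'| < e -> `|v - v'| < e ->
      `|u'| = `|v'| -> `|u| <= `|v| + (e + e).
    move=> uu vv uv; have h1 : `|u| <= `|u - u'| + `|v'|.
      by rewrite -uv -{1}[u](subrK u') ler_normD.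
    have h2 : `|v'| <= `|v - v'| + `|v|.
      by rewrite distrC -{1}[v'](subrK v) ler_normD.
    apply: (le_trans h1); apply: (le_trans (lerD (ltW uu) h2)).
    by rewrite addrA addrC lerD2l lerD2l ltW.
  move=> xy; apply/eqP; rewrite eq_le; apply/andP; split;
    apply/ler_addgt0Pr => e e0; have e20 : 0 < e / 2 by rewrite divr_gt0.
    have [l [xl yl]] := xy _ e20; rewrite [e in leRHS]splitr.
    by apply: aux yl xl _; rewrite (norm_lincomb fg).
  have [l [xl yl]] := xy _ e20; rewrite [e in leRHS]splitr.
  by apply: aux xl yl _; rewrite (norm_lincomb fg).
have ext_ex x : exists y, ext x y.
  have pos n : 0 < n.+1%:R^-1 :> C by rewrite invr_gt0 ltr0n.
  have /choice[l lP] n := f_dense x (pos n).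
  have near_l e : 0 < e -> \forall n \near \oo, `|x - lincomb f (l n)| < e.
    move=> e0.
    apply: filterS ((cvgr0Pnorm_lt _).1 (@cvg_natSinv R) _ e0) => n.
    by rewrite ger0_norm ?invr_ge0//; exact: lt_trans.
  have [y ly] : exists y : H, (fun n => lincomb g (l n)) @ \oo --> y.
    apply: cauchy_norm_cvg => e e0; have e20 : 0 < e / 2 by rewrite divr_gt0.
    have [N _ HN] := near_l _ e20; exists N.
    exists N => // n /= Nn; rewrite -(norm_lincombB fg) -[_ - _](subrKA x).
    rewrite (splitr e) (le_lt_trans (ler_normD _ _))// ltrD//; last exact: HN.
    by rewrite distrC; exact: (HN N (leqnn N)).
  exists y => e e0.
  have [N1 _ HN1] := near_l _ e0.
  have [N2 _ HN2] := (cvgrPdist_lt _ _).1 ly _ e0.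
  exists (l (maxn N1 N2)); split; first by apply: HN1; exact: leq_maxl.
  by apply: HN2; exact: leq_maxr.
have ext_uniq x y y' : ext x y -> ext x y' -> y = y'.
  move=> xy xy'; have := ext_norm _ _ (ext_lin (-1) _ _ _ _ xy' xy).
  rewrite !scaleN1r addNr normr0 => /eqP; rewrite normr_eq0 addrC subr_eq0.
  by move/eqP.
have [V VP] := choice ext_ex.
exists V; split.
- move=> c u v; apply: ext_uniq (VP _) _; exact: ext_lin.
- by move=> x; exact: ext_norm.
- move=> a; apply: ext_uniq (VP _) _ => e e0.
  by exists [:: (1, a)]; rewrite /lincomb !big_seq1 !scale1r !subrr normr0.
Qed.

End dense_family.

(** Each [act t] preserves the Gram kernel and so induces an isometry. The semigroup laws and strong
    continuity hold on the vectors [f a] and pass to all of [H] by density, since isometries do not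
    enlarge errors. *)
Lemma isometric_semigroup_extension (M : TopologicalNmodule.type) (A : Type)
    (f : A -> H) (act : M -> A -> A) :
  (forall x e, 0 < e -> exists l, `|x - lincomb f l| < e) ->
  (forall t a b, dot (f a) (f b) = dot (f (act t a)) (f (act t b))) ->
  (forall a, act 0 a = a) -> (forall s t a, act (s + t) a = act s (act t a)) ->
  (forall a, continuous (fun t => f (act t a))) ->
  exists2 V : M -> H -> H, contractive_semigroup H M V /\ forall t x, `|V t x| = `|x| &
    forall t a, V t (f a) = f (act t a).
Proof.
move=> f_dense f_act act0 actD f_cont.
have /choice[V VP] t := isometric_extension f_dense (f_act t).
have Vlin t : linear (V t) by have [] := VP t.
have Viso t x : `|V t x| = `|x| by have [_ ->] := VP t.
have Vf t a : V t (f a) = f (act t a) by have [_ _ ->] := VP t.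
exists V => //; split=> //; split.
- by move=> t; apply: le_contraction => // x; rewrite Viso.
- move=> x t; apply/cvgrPdist_lt => e e0.
  have e30 : 0 < e / 3 by rewrite divr_gt0.
  have [l xl] := f_dense x _ e30.
  have VB s u v : V s (u - v) = V s u - V s v.
    by rewrite addrC -scaleN1r Vlin scaleN1r addrC.
  have Vl s : V s (lincomb f l) = lincomb (fun a => f (act s a)) l.
    rewrite /lincomb; elim: (l) => [|p l' IH]; last by rewrite !big_cons Vlin Vf IH.
    by rewrite !big_nil; have := VB s 0 0; rewrite !subrr.
  have Vlc : (fun s => V s (lincomb f l)) @ t --> V t (lincomb f l).
    have -> : (fun s => V s (lincomb f l)) = (fun s => lincomb (fun a => f (act s a)) l).
      exact/funext.
    rewrite Vl; elim: (l) => [|p l' IH].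
      have -> : (fun s => lincomb (fun a => f (act s a)) [::]) = fun=> 0.
        by apply/funext => s; rewrite /lincomb big_nil.
      by rewrite /lincomb big_nil; exact: cvg_cst.
    have lc s : lincomb (fun a => f (act s a)) (p :: l') =
        p.1 *: f (act s p.2) + lincomb (fun a => f (act s a)) l'.
      by rewrite /lincomb big_cons.
    rewrite lc (funext lc); apply: cvgD => //; apply: cvgZr; exact: f_cont.
  have e3 := split_third e.
  apply: filterS ((cvgrPdist_lt _ _).1 Vlc _ e30) => s Vs.
  have -> : V t x - V s x = V t (x - lincomb f l)
      + (V t (lincomb f l) - V s (lincomb f l)) + V s (lincomb f l - x).
    by rewrite !VB !addrA !subrK.
  rewrite e3 (le_lt_trans (ler_normD _ _))// ltrD//; last by rewrite Viso distrC.
  by rewrite (le_lt_trans (ler_normD _ _))// ltrD// Viso.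
- apply/funext => x; apply: (eq_dense_lincomb f_dense) => //.
    by move=> y; rewrite Viso.
  by move=> a; rewrite Vf act0.
- move=> s t; apply/funext => x; apply: (eq_dense_lincomb f_dense) => //=.
  + by move=> c u v /=; rewrite !Vlin.
  + by move=> y; rewrite Viso.
  + by move=> y; rewrite !Viso.
  + by move=> a; rewrite !Vf actD.
Qed.

End isometric_extension.

(** * Isometric dilations inside H *)

Section dilation.
Context {R : realType} {H : completeNormedModType R[i]}.
Variable dot : {dot H for @Num.conj R[i]}.
Hypothesis norm_dot : forall x : H, `|x| ^+ 2 = dot x x.
Hypothesis infH : ~ finite_dimensional H.
Context {M : TopologicalNmodule.type}.
Variables (ax : time_axis M) (T : M -> H -> H).
Hypothesis sgT : contractive_semigroup H M T.
Variables (x : nat -> H) (m : nat).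
Local Notation C := R[i].
Local Notation ker := (dil_ker dot ax T).

(** The vectors to be kept come first, at time 0, since [gram_realization] prescribes an initial
    segment; then every pair of a dense time and a vector is enumerated. Repetitions are harmless
    for a semidefinite kernel. *)
Let index (k : nat) : M * H :=
  if (k < m)%N then (0, x k)
  else let ij := odflt (0, 0)%N (unpickle (k - m)) in (tdense ax ij.1, x ij.2).

Let index_dense i j : index (m + pickle (i, j)) = (tdense ax i, x j).
Proof. by rewrite /index ltnNge leq_addr/= addKn pickleK. Qed.

Lemma dense_dilation_vectors : exists2 g : nat -> H,
  forall k l, dot (g k) (g l) = ker (index k) (index l) &
  forall k, (k < m)%N -> g k = x k.
Proof.
apply: (gram_realization infH) => [i j|n c|i j im jm].
- exact: dil_kerC.
- have := dil_ker_ge0 norm_dot ax sgT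
    [seq ((index i).1, c i *: (index i).2) | i : 'I_n <- index_enum 'I_n].
  rewrite big_map; under eq_bigr do rewrite big_map.
  rewrite [X in 0 <= X -> _](_ : _ =
    \sum_(i < n) \sum_(j < n) c i * (c j)^* * ker (index i) (index j))//.
  apply: eq_bigr => i _; apply: eq_bigr => j _; rewrite (dil_kerZ _ _ sgT).
  by case: (index i) (index j) => ? ? [? ?].
- by rewrite /index im jm (dil_ker0 _ _ sgT) (semigroup0 sgT).
Qed.

(** The squared distance between the Gram vectors of [y] at times [r] and [s] is the sum of two such
    differences, so this is the Cauchy estimate for [dilation_vectors]. *)
Let ker_near (t : M) (y : H) (e : C) : 0 < e ->
  exists2 V : set M, nbhs t V &
    forall r s, V r -> V s -> `|(`|y| ^+ 2 - ker (r, y) (s, y))| < e.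
Proof.
move=> e0; have := (cvgrPdist_lt _ _).1
  (dil_ker_continuous norm_dot sgT (ax := ax) (x := y) (y := y) (x0 := (t, t))) _ e0.
move=> [[A B] /= [tA tB] AB]; exists (A `&` B); first exact: filterI.
move=> r s [Ar _] [_ Bs]; have := AB (r, s) (conj Ar Bs).
by rewrite /= (dil_ker_diag norm_dot _ sgT).
Qed.

Let ker_cvg {I : Type} (F : set_system I) (a b : I -> M) (t s : M) y z :
  Filter F -> a @ F --> t -> b @ F --> s ->
  (fun n => ker (a n, y) (b n, z) : C^o) @ F --> (ker (t, y) (s, z) : C^o).
Proof.
move=> FF at_ bs.
exact: (cvg_comp _ _ (cvg_pair at_ bs)
  (dil_ker_continuous norm_dot sgT (x0 := (t, s)))).
Qed.

(** Dense times are extended to all times by norm limits. The Gram identity passes to the limit in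
    one argument ([hg]), then in the other ([hh]). *)
Lemma dilation_vectors : exists2 h : M -> nat -> H,
  forall t s i j, dot (h t i) (h s j) = ker (t, x i) (s, x j) &
  forall i, (i < m)%N -> h 0 i = x i.
Proof.
have [g gk gx] := dense_dilation_vectors.
have lim (t : M) (j : nat) : exists v : H, exists2 u : nat -> nat,
    (fun n => tdense ax (u n)) @ \oo --> t &
    (fun n => g (m + pickle (u n, j))%N) @ \oo --> v.
  have [u ut] := tdenseP ax t.
  suff [v gv] : exists v : H, (fun n => g (m + pickle (u n, j))%N) @ \oo --> v.
    by exists v, u.
  apply: cauchy_norm_cvg => e e0.
  have e20 : 0 < e ^+ 2 / 2 by rewrite divr_gt0// exprn_gt0.
  have [V tV VP] := ker_near t (x j) e20.
  have [N _ HN] : \forall n \near \oo, V (tdense ax (u n)) by exact: ut.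
  exists N; exists N => // n /= Nn; apply: norm_lt_of_sqr => //.
  rewrite -[ltLHS]ger0_norm ?exprn_ge0// (sqr_normB norm_dot) !norm_dot !gk.
  rewrite !index_dense !(dil_ker_diag norm_dot _ sgT) opprD addrACA (splitr (e ^+ 2)).
  have VN := HN N (leqnn N); have Vn := HN n Nn.
  by rewrite (le_lt_trans (ler_normD _ _))// ltrD//; exact: VP.
have /choice[h hP] (p : M * nat) := lim p.1 p.2.
have hg t j k : dot (h (t, j)) (g k) = ker (t, x j) (index k).
  have [u /= ut gh] := hP (t, j).
  have c1 : (fun n => dot (g (m + pickle (u n, j))%N) (g k) : C^o) @ \oo -->
      (dot (h (t, j)) (g k) : C^o).
    by apply: (cvg_dot norm_dot) => //; exact: cvg_cst.
  suff c2 : (fun n => dot (g (m + pickle (u n, j))%N) (g k) : C^o) @ \oo -->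
      (ker (t, x j) (index k) : C^o).
    exact: (cvg_unique (@norm_hausdorff _ C^o) c1 c2).
  under eq_fun do rewrite gk index_dense.
  case: (index k) => s y.
  by apply: ker_cvg => //; exact: cvg_cst.
have hh t s i j : dot (h (t, i)) (h (s, j)) = ker (t, x i) (s, x j).
  have [u /= us gh] := hP (s, j).
  have c1 : (fun n => dot (h (t, i)) (g (m + pickle (u n, j))%N) : C^o) @ \oo -->
      (dot (h (t, i)) (h (s, j)) : C^o).
    by apply: (cvg_dot norm_dot) => //; exact: cvg_cst.
  suff c2 : (fun n => dot (h (t, i)) (g (m + pickle (u n, j))%N) : C^o) @ \oo -->
      (ker (t, x i) (s, x j) : C^o).
    exact: (cvg_unique (@norm_hausdorff _ C^o) c1 c2).
  under eq_fun do rewrite hg index_dense.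
  by apply: ker_cvg => //; exact: cvg_cst.
exists (fun t i => h (t, i)) => // i im.
(* The limit vector at time 0 and the prescribed one have the same Gram data, so their squared
   distance is 0. *)
apply/eqP; rewrite -subr_eq0 -normr_eq0 -sqrf_eq0 (sqr_normB norm_dot).
rewrite -(gx _ im) -[dot (g i) _](@conjCK C) -dotC !hg !norm_dot hh gk.
rewrite /index im (dil_ker_diag norm_dot _ sgT).
by rewrite geC0_conj ?exprn_ge0// subrr.
Qed.

(** [V t] shifts the times of the Gram vectors, so [V t (x i)] is [h t i], and its inner product
    with [x j], sitting at time 0, is the kernel value [<T(t) x_i, x_j>]. *)
Lemma isometric_dilation : exists2 V : M -> H -> H,
  contractive_semigroup H M V /\ forall t y, `|V t y| = `|y| &
  forall t i j, (i < m)%N -> (j < m)%N -> dot (V t (x i)) (x j) = dot (T t (x i)) (x j).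
Proof.
have [h hh hx] := dilation_vectors.
pose ortho b := forall t i, dot b (h t i) = 0.
(* The vectors orthogonal to all [h t i], with the trivial action, complete *)
(* the family to a total one.                                               *)
pose f (a : M * nat + H) :=
  match a with inl ti => h ti.1 ti.2 | inr b => if `[< ortho b >] then b else 0 end.
pose act (s : M) (a : M * nat + H) :=
  match a with inl ti => inl (s + ti.1, ti.2) | inr b => inr b end.
have fo t i b : dot (f (inr b)) (h t i) = 0.
  by rewrite /f; case: asboolP => [|_]; [exact|rewrite linear0l].
have h_cont i : continuous (h ^~ i).
  move=> t; apply/subr_cvg0; apply: (@cvg0_sqr_norm _ _ _ _ _
    (fun s => `|x i| ^+ 2 + `|x i| ^+ 2
      - (ker (s, x i) (t, x i) + ker (t, x i) (s, x i)))) => [s|].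
    by rewrite (sqr_normB norm_dot) !norm_dot !hh !(dil_ker_diag norm_dot _ sgT) !norm_dot.
  rewrite -[X in _ --> X](_ : `|x i| ^+ 2 + `|x i| ^+ 2
      - (ker (t, x i) (t, x i) + ker (t, x i) (t, x i)) = 0); last first.
    by rewrite !(dil_ker_diag norm_dot _ sgT) subrr.
  apply: (@cvgB _ C^o); first exact: cvg_cst.
  by apply: (@cvgD _ C^o); apply: ker_cvg => //; exact: cvg_cst.
have [y e e0||||a|V isoV Vf] := @isometric_semigroup_extension _ _ _ norm_dot M _ f act.
- pose W := [set w : H | exists l, w = lincomb (fun ti => h ti.1 ti.2) l].
  have WD c u v : W u -> W v -> W (c *: u + v).
    by move=> [l ->] [l' ->]; rewrite -lincombP; eexists.
  have Wh t i : W (h t i).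
    by exists [:: (1, (t, i))]; rewrite /lincomb big_seq1 scale1r.
  have [w [u [[l ->] uW yl]]] := dense_add_orthogonal norm_dot (ex_intro _ _ (Wh 0 0)) WD y e0.
  exists ([seq (p.1, inl p.2) | p <- l] ++ [:: (1, inr u)]).
  rewrite lincomb_cat {1}/lincomb big_map /lincomb big_seq1 scale1r /f /=.
  by rewrite asboolT// => t i; apply: uW; exact: Wh.
- move=> t [[s i]|b] [[s' i']|b'] //=.
  + by rewrite !hh dil_kerDl.
  + by rewrite ![dot (h _ _) _]dotC !fo.
  + by rewrite !fo.
- by move=> [[t i]|b]//; rewrite /act add0r.
- by move=> s t [[r i]|b]//; rewrite /act /= addrA.
- case: a => [[s i]|b] t /=; last exact: cvg_cst.
  apply: (cvg_comp (fun t => t + s) (h ^~ i)); last exact: h_cont.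
  apply: (cvg_comp (fun t => (t, s)) (fun p : M * M => p.1 + p.2)
    _ (@add_continuous M (t, s))).
  by apply: cvg_pair => //; exact: cvg_cst.
exists V => // t i j im jm; rewrite -{1}(hx i im) -{1}(hx j jm).
rewrite -[h 0 i]/(f (inl (0, i))) Vf/= hh addr0.
exact: dil_ker0.
Qed.

End dilation.

(** * Neighbourhoods in the space of semigroups *)

Section Cs_nbhs.
Context {R : realType} {H : completeNormedModType R[i]}.
Variable dot : {dot H for @Num.conj R[i]}.
Context {M : TopologicalNmodule.type}.
Variable ax : time_axis M.
Local Notation C := R[i].
Local Notation Cs := (Cs dot M).

(** The inequality is not strict, so that these basic neighbourhoods are closed under pointwise
    limits ([Cs_ball_limit]). *)
Definition Cs_ball (T : Cs) (l : seq (H * H)) (n : nat) (e : R) : set Cs :=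
  [set S | forall p, p \in l -> forall t, texh ax n t ->
    `|dot (val S t p.1 - val T t p.1) p.2| <= (e%:C)%C].

Lemma compact_sub_exh (K : set M) : compact K -> exists n, K `<=` texh ax n.
Proof.
move=> /compact_near_coveringP cK.
have [|N _ NP] := cK nat \oo (texh ax) _.
  move=> t _; have [n tn] := texh_nbhs ax t.
  exists (texh ax n, [set m | (n <= m)%N]) => /=.
    by split => //; exact: nbhs_infty_ge.
  by move=> [s m] /= [sn nm]; exact: (texh_mono nm).
by exists N; exact: NP (leqnn N).
Qed.

Lemma nbhs_Cs_ball (T : Cs) l n e : 0 < e -> nbhs T (Cs_ball T l n e).
Proof.
move=> e0; elim: l => [|p l IH]; first exact: filterS filterT.
have Tp := (@Cs_cvgP _ _ dot M (nbhs T) T _).1 (@cvg_id _ _) p.1 p.2 _ (@texh_compact _ ax n) _ e0.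
apply: filterS (filterI IH (Tp _)) => S [Sl Sp] q; rewrite inE => /predU1P[->|/Sl//] t tn.
rewrite -[leLHS]real_complexRe// lecR -lee_fin; apply: le_trans Sp.
by apply: ereal_sup_ubound; exists t.
Qed.

Lemma Cs_ball_nbhs (T : Cs) (U : set Cs) : nbhs T U ->
  exists l n e, 0 < e /\ Cs_ball T l n e `<=` U.
Proof.
(* The balls generate a filter; it converges to [T] by [Cs_cvgP] and hence contains every
   neighbourhood of [T]. *)
pose F : set_system Cs := [set U | exists l n e, 0 < e /\ Cs_ball T l n e `<=` U].
have FF : Filter F.
  split.
  - by exists [::], 0%N, 1; split.
  - move=> P Q [l [n [e [e0 P_]]]] [l' [n' [e' [e'0 Q_]]]].
    exists (l ++ l'), (maxn n n'), (Num.min e e'); split.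
      by rewrite lt_min e0.
    move=> S SB; split; [apply: P_ | apply: Q_] => p pl t tn.
      apply: le_trans (SB p _ t _) _; rewrite ?mem_cat ?pl//.
        by apply: texh_mono tn; exact: leq_maxl.
      by rewrite lecR ge_min lexx.
    apply: le_trans (SB p _ t _) _; rewrite ?mem_cat ?pl ?orbT//.
      by apply: texh_mono tn; exact: leq_maxr.
    by rewrite lecR ge_min lexx orbT.
  - move=> P Q PQ [l [n [e [e0 P_]]]]; exists l, n, e; split => //.
    exact: subset_trans P_ PQ.
suff : F --> T by move=> FT /FT.
apply/Cs_cvgP => xi eta K /compact_sub_exh[n Kn] e e0.
exists [:: (xi, eta)], n, e; split => // S SB; apply: ge_ereal_sup => _ [t Kt <-].
rewrite lee_fin -lecR real_complexRe//.
by apply: (SB (xi, eta)); [rewrite inE | exact: Kn].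
Qed.

End Cs_nbhs.

(** * Isometric semigroups: density and strong closeness *)

Section isometric_semigroups.
Context {R : realType} {H : completeNormedModType R[i]}.
Variable dot : {dot H for @Num.conj R[i]}.
Hypothesis norm_dot : forall x : H, `|x| ^+ 2 = dot x x.
Hypothesis infH : ~ finite_dimensional H.
Context {M : TopologicalNmodule.type}.
Variable ax : time_axis M.
Local Notation C := R[i].
Local Notation Cs := (Cs dot M).

Definition isometric (S : Cs) := forall t (x : H), `|val S t x| = `|x|.

Lemma Cs_semigroup (S : Cs) : contractive_semigroup H M (val S).
Proof. exact: set_valP. Qed.

Definition to_Cs (V : M -> H -> H) (sgV : contractive_semigroup H M V) : Cs :=
  SigSub (mem_set sgV).

Lemma isometric_dense (T : Cs) (U : set Cs) : nbhs T U ->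
  exists2 V, isometric V & U V.
Proof.
move=> /(Cs_ball_nbhs ax)[l [n [e [e0 TU]]]].
pose s := map fst l ++ map snd l.
have [V [sgV isoV] VT] :=
  isometric_dilation norm_dot infH ax (Cs_semigroup T) (nth 0 s) (size s).
exists (to_Cs sgV) => //; apply: TU => p pl t _.
have [i im ->] : exists2 i, (i < size s)%N & p.1 = nth 0 s i.
  have ps : p.1 \in s by rewrite mem_cat map_f.
  by exists (index p.1 s); rewrite ?index_mem ?nth_index.
have [j jm ->] : exists2 i, (i < size s)%N & p.2 = nth 0 s i.
  have ps : p.2 \in s by rewrite mem_cat map_f ?orbT.
  by exists (index p.2 s); rewrite ?index_mem ?nth_index.
by rewrite linearBl/= VT// subrr normr0 lecR ltW.
Qed.

(* For vectors of equal norm, [|u - v|^2 = - 2 Re <u - v, v>]. *)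
Lemma sqr_dist_eq_norm (u v : H) : `|u| = `|v| ->
  `|u - v| ^+ 2 <= `|dot (u - v) v| *+ 2.
Proof.
move=> uv; rewrite -[leLHS]ger0_norm ?exprn_ge0// (sqr_normB norm_dot) uv norm_dot.
have -> : dot v v + dot v v - (dot u v + dot v u) =
    - (dot (u - v) v + (dot (u - v) v)^*).
  by rewrite -dotC linearBl linearBr/=; ring.
rewrite normrN (le_trans (ler_normD _ _))// norm_conjC mulr2n.
exact: lexx.
Qed.

(** By [sqr_dist_eq_norm] it is enough to test [S t x - V t x] against [V t x]. This vector moves
    with [t], whereas a weak neighbourhood tests fixed vectors; near [t0] it is replaced by
    [V t0 x], and compactness of [texh ax n] leaves finitely many [t0]. *)
Lemma nbhs_isometric_sot (V : Cs) (x : H) n (e : C) : isometric V -> 0 < e ->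
  \forall S \near V, isometric S -> forall t, texh ax n t ->
    `|val S t x - val V t x| <= e.
Proof.
move=> isoV e0.
have /compact_near_coveringP cK := @texh_compact _ ax n.
have Vcont : continuous ((val V) ^~ x) by have [_ + _ _] := Cs_semigroup V; apply.
suff : \forall S \near V, texh ax n `<=` (fun t => isometric S -> texh ax n t ->
    `|val S t x - val V t x| <= e).
  by apply: filterS => S SP isoS t tn; exact: SP.
apply: (cK Cs (nbhs V) (fun S t => isometric S -> texh ax n t ->
    `|val S t x - val V t x| <= e)) => t0 t0n.
(* The sum of the two norms bounds [S t x - V t x]; the 1 keeps the divisor positive. Each of the
   two error terms gets [e ^+ 2 / 4], and [sqr_dist_eq_norm] doubles their sum. *)
have c0 : 0 < `|x| + `|x| + 1 by rewrite ltr_wpDl ?addr_ge0.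
have e40 : 0 < e ^+ 2 / 4 by rewrite divr_gt0 ?exprn_gt0.
have er : 0 < complex.Re (e ^+ 2 / 4) by rewrite -ltcR real_complexRe// ltW.
exists ([set t | `|val V t0 x - val V t x| < e ^+ 2 / 4 / (`|x| + `|x| + 1)],
    Cs_ball ax V [:: (x, val V t0 x)] n (complex.Re (e ^+ 2 / 4))) => /=.
  split; last exact: nbhs_Cs_ball.
  by apply: (cvgrPdist_lt _ _).1 (Vcont t0) _ _; rewrite divr_gt0.
move=> [t S] /= [tt0 SB] isoS tn.
rewrite -(@ler_pXn2r _ 2) ?nnegrE ?normr_ge0 ?(ltW e0)//.
rewrite (le_trans (sqr_dist_eq_norm _))// ?isoS ?isoV// -[e ^+ 2](@divfK _ 4 _)//.
rewrite [_ * 4](_ : _ = (e ^+ 2 / 4 + e ^+ 2 / 4) *+ 2); last by ring.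
rewrite ler_pMn2r//.
have -> : dot (val S t x - val V t x) (val V t x) =
    dot (val S t x - val V t x) (val V t0 x) -
    dot (val S t x - val V t x) (val V t0 x - val V t x).
  by rewrite [X in _ = _ - X]linearBr/=; ring.
rewrite (le_trans (ler_normB _ _))// lerD//.
  have := SB (x, val V t0 x) (mem_head _ _) t tn.
  by rewrite real_complexRe// ltW.
rewrite (le_trans (cauchy_schwarz norm_dot _ _))//.
rewrite (@le_trans _ _ ((`|x| + `|x| + 1) * `|val V t0 x - val V t x|))//.
  rewrite ler_wpM2r// (le_trans (ler_normB _ _))// isoS isoV.
  by rewrite lerDl.
by rewrite mulrC -ler_pdivlMr// ltW.
Qed.

End isometric_semigroups.

(** * The Baire property *)

Lemma separable_dense_seq (K : numFieldType) (V : normedModType K) :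
  separable_space V ->
  exists x : nat -> V, forall y e, 0 < e -> exists j, `|y - x j| < e.
Proof.
move=> [D /countable_injP[f finj] Dd].
exists (fun n => xget 0 [set y | D y /\ f y = n]) => y e e0.
have [||z [yz Dz]] := Dd (ball y e)^°.
- by exists y; exact: nbhsx_ballx.
- exact: open_interior.
exists (f z).
have [|/= Dz' fz'] := @xgetPex _ 0 [set y | D y /\ f y = f z]; first by exists z.
rewrite (finj _ z _ _ fz') ?inE//; move: (interior_subset yz).
by rewrite -ball_normE.
Qed.

Section baire.
Context {R : realType} {H : completeNormedModType R[i]}.
Variable dot : {dot H for @Num.conj R[i]}.
Hypothesis norm_dot : forall x : H, `|x| ^+ 2 = dot x x.
Hypothesis infH : ~ finite_dimensional H.
Hypothesis sepH : separable_space H.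
Context {M : TopologicalNmodule.type}.
Variable ax : time_axis M.
Local Notation C := R[i].
Local Notation Cs := (Cs dot M).

Section limit.
Variable V : nat -> Cs.
Hypothesis isoV : forall k, isometric (V k).
Hypothesis V_cauchy : forall (y : H) n (e : C), 0 < e -> exists N, forall k,
  (N <= k)%N -> forall t, texh ax n t -> `|val (V N) t y - val (V k) t y| < e.

(** Strong limits keep norms, so the limit is isometric; uniformity on the sets [texh ax n], which
    are neighbourhoods of their points for large [n], carries strong continuity over. For the
    semigroup law, the isometry [V k s] preserves the distance from [V k t y] to [S t y]. *)
Lemma isometric_limit : exists2 S : Cs, isometric S &
  forall t y, (fun k => val (V k) t y) @ \oo --> val S t y.
Proof.
have exh (t : M) : exists n, texh ax n t.
  by have [n tn] := texh_nbhs ax t; exists n; exact: nbhs_singleton tn.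
have lim (p : M * H) : exists z : H, (fun k => val (V k) p.1 p.2) @ \oo --> z.
  apply: cauchy_norm_cvg => e e0; have [n tn] := exh p.1.
  have [N HN] := V_cauchy p.2 n e0; exists N.
  by exists N => // k /= Nk; exact: HN.
have /choice[f fP] := lim.
pose S t y := f (t, y).
have VS t y : (fun k => val (V k) t y) @ \oo --> S t y := fP (t, y).
have uniq (u : nat -> H) (a b : H) : u @ \oo --> a -> u @ \oo --> b -> a = b.
  by move=> ua ub; exact: (cvg_unique (@norm_hausdorff _ H) ua ub).
have Slin t : linear (S t).
  move=> c u v; apply: uniq (VS t _) _.
  under eq_fun do rewrite (semigroup_linear (Cs_semigroup (V _))).
  by apply: cvgD; [apply: cvgZr|]; exact: VS.
have Siso t y : `|S t y| = `|y|.
  have c1 : (fun k => `|val (V k) t y| : C^o) @ \oo --> (`|S t y| : C^o).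
    exact: cvg_norm (VS t y).
  have c2 : (fun k => `|val (V k) t y| : C^o) @ \oo --> (`|y| : C^o).
    by under eq_fun do rewrite isoV; exact: cvg_cst.
  exact: (cvg_unique (@norm_hausdorff _ C^o) c1 c2).
have SB t u v : S t (u - v) = S t u - S t v.
  by rewrite addrC -scaleN1r Slin scaleN1r addrC.
have S0 y : S 0 y = y.
  apply: uniq (VS 0 y) _; under eq_fun do rewrite (semigroup0 (Cs_semigroup (V _))).
  exact: cvg_cst.
have SD s t y : S (s + t) y = S s (S t y).
  apply: uniq (VS _ y) _; apply/cvgrPdist_lt => e e0.
  have e20 : 0 < e / 2 by rewrite divr_gt0.
  have h1 := (cvgrPdist_lt _ _).1 (VS t y) _ e20.
  have h2 := (cvgrPdist_lt _ _).1 (VS s (S t y)) _ e20.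
  apply: filterS (filterI (h1 _) (h2 _)) => k [k1 k2].
  rewrite (semigroupD (Cs_semigroup (V k))).
  rewrite -(subrKA (val (V k) s (S t y))) (splitr e).
  rewrite (le_lt_trans (ler_normD _ _))// ltrD//.
  have := semigroup_linear (Cs_semigroup (V k)) s (-1) (val (V k) t y) (S t y).
  by rewrite !scaleN1r [in RHS]addrC => <-; rewrite isoV addrC.
have Scont y : continuous (S ^~ y).
  move=> t; apply/cvgrPdist_lt => e e0.
  have e30 : 0 < e / 3 by rewrite divr_gt0.
  have e60 : 0 < e / 3 / 2 by rewrite divr_gt0.
  have [n tn] := texh_nbhs ax t.
  have [N HN] := V_cauchy y n e60.
  have close s : texh ax n s -> `|S s y - val (V N) s y| < e / 3.
    move=> sn; have [K _ HK] := (cvgrPdist_lt _ _).1 (VS s y) _ e60.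
    have kK := HK _ (leq_maxr N K); have kN := HN _ (leq_maxl N K) s sn.
    rewrite -(subrKA (val (V (maxn N K)) s y)) (splitr (e / 3)).
    by rewrite (le_lt_trans (ler_normD _ _))// ltrD// distrC.
  have Vcont : continuous ((val (V N)) ^~ y).
    by have [_ + _ _] := Cs_semigroup (V N); apply.
  have h := (cvgrPdist_lt _ _).1 (Vcont t) _ e30.
  apply: filterS (filterI tn (h _)) => s [sn sV].
  rewrite -(subrKA (val (V N) t y)) -[X in _ + X](subrKA (val (V N) s y)).
  rewrite (split_third e) -[ltRHS]addrA (le_lt_trans (ler_normD _ _))// ltrD//.
    by apply: close; exact: nbhs_singleton tn.
  rewrite (le_lt_trans (ler_normD _ _))// ltrD// distrC; exact: close.
have sgS : contractive_semigroup H M S.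
  split; [|exact: Scont|exact/funext|by move=> s t; apply/funext => y; exact: SD].
  by move=> t; apply: le_contraction => // y; rewrite Siso.
by exists (to_Cs dot sgS).
Qed.

Lemma Cs_ball_limit (S T : Cs) l n e :
  (forall t y, (fun k => val (V k) t y) @ \oo --> val S t y) ->
  (\forall k \near \oo, Cs_ball ax T l n e (V k)) -> Cs_ball ax T l n e S.
Proof.
move=> VS [N _ NB] p pl t tn; apply/ler_addgt0Pr => d d0.
have c : (fun k => dot (val (V k) t p.1) p.2 : C^o) @ \oo -->
    (dot (val S t p.1) p.2 : C^o).
  by apply: (cvg_dot norm_dot) => //; exact: cvg_cst.
have [K _ HK] := (cvgrPdist_lt _ _).1 c _ d0.
have kK := HK _ (leq_maxr N K); have kN := NB _ (leq_maxl N K) p pl t tn.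
have -> : dot (val S t p.1 - val T t p.1) p.2 =
    dot (val (V (maxn N K)) t p.1 - val T t p.1) p.2 +
    (dot (val S t p.1) p.2 - dot (val (V (maxn N K)) t p.1) p.2).
  by rewrite !linearBl/=; ring.
by rewrite (le_trans (ler_normD _ _))// lerD// ltW.
Qed.

End limit.

(** A state is a ball with isometric centre. Each ball lies in the previous one and in the next open
    set, and is [tight]: its isometric members agree with the centre up to [1/(k+1)] on the first
    [k + 1] dense vectors over the [k]-th compact set. The centres are therefore strongly Cauchy,
    and their limit stays in every ball. *)
Theorem Cs_baire : baire_space Cs.
Proof.
have [x xd] := separable_dense_seq sepH.
move=> U Uod O [T0 OT0] Oo.
pose state : Type := Cs * (seq (H * H) * nat * R).
pose good (st : state) := isometric st.1 /\ 0 < st.2.2.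
pose bl (st : state) := Cs_ball ax st.1 st.2.1.1 st.2.1.2 st.2.2.
pose tight k (st : state) := forall S, bl st S -> isometric S ->
  forall j t, (j <= k)%N -> texh ax k t ->
    `|val S t (x j) - val st.1 t (x j)| <= k.+1%:R^-1.
have [V0 isoV0 OV0] : exists2 V, isometric V & O V.
  by apply: (isometric_dense norm_dot infH ax (T := T0)); exact: open_nbhs_nbhs.
have step_nbhs (V : Cs) k (W : set Cs) : isometric V -> nbhs V W ->
    exists st, [/\ good st, bl st `<=` W & tight k st].
  move=> isoV VW.
  have VT : \forall S \near V, isometric S -> forall j t, (j <= k)%N ->
      texh ax k t -> `|val S t (x j) - val V t (x j)| <= k.+1%:R^-1.
    have k0 : 0 < k.+1%:R^-1 :> C by rewrite invr_gt0 ltr0n.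
    suff : \forall S \near V, forall j : 'I_k.+1, isometric S -> forall t,
        texh ax k t -> `|val S t (x j) - val V t (x j)| <= k.+1%:R^-1.
      by apply: filterS => S SP isoS j t jk; exact: (SP (Ordinal (jk : (j < k.+1)%N))).
    apply: (@filter_forall Cs 'I_k.+1 (fun j S => isometric S -> forall t,
      texh ax k t -> `|val S t (x j) - val V t (x j)| <= k.+1%:R^-1) (nbhs V) _) => j.
    exact: nbhs_isometric_sot.
  have [l [n [e [e0 sub]]]] := Cs_ball_nbhs ax (filterI VW VT).
  exists (V, (l, n, e)); split => //.
    by move=> S /sub[].
  by move=> S /sub[_]; apply.
have /choice[next nextP] (kst : nat * state) : exists st, good kst.2 ->
    [/\ good st, bl st `<=` bl kst.2 `&` U kst.1 & tight kst.1.+1 st].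
  have [[isoV e0]|] := pselect (good kst.2); last by exists kst.2.
  have VB : nbhs kst.2.1 (bl kst.2) by exact: nbhs_Cs_ball.
  (* Density of the open set gives only some semigroup [T] in the interior of the ball;
     [isometric_dense] then moves it to an isometric centre. *)
  have [T [IT UT]] := (Uod kst.1).2 (bl kst.2)^° 
    (ex_intro _ kst.2.1 VB) (@open_interior _ _).
  have nT : nbhs T (bl kst.2 `&` U kst.1).
    by apply: filterI => //; apply: open_nbhs_nbhs; split => //; exact: (Uod kst.1).1.
  have [V isoV' VU] := isometric_dense norm_dot infH ax (nbhs_interior nT).
  by have [st stP] := step_nbhs V kst.1.+1 _ isoV' VU; exists st.
have [st0 [good0 st0O tight0]] := step_nbhs V0 0%N O isoV0 (open_nbhs_nbhs (conj Oo OV0)).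
pose st := fix st k := if k is k'.+1 then next (k', st k') else st0.
have stP k : good (st k) /\ tight k (st k).
  by elim: k => //= k [IH _]; have [] := nextP (k, st k) IH.
have bl_next k : bl (st k.+1) `<=` bl (st k) `&` U k.
  by have [] := nextP (k, st k) (stP k).1.
have bl_mono k j : (k <= j)%N -> bl (st j) `<=` bl (st k).
  move=> /subnK <-; elim: (j - k)%N => // i IH; apply: subset_trans IH.
  by move=> S /(bl_next (i + k)%N)[].
pose V k := (st k).1.
have isoV k : isometric (V k) by have [[]] := stP k.
have bl_self k : bl (st k) (V k).
  move=> p pl t tn; rewrite subrr linear0l normr0 lecR ltW//.
  by have [[]] := stP k.
have Vc (y : H) n (e : C) : 0 < e -> exists N, forall k,
    (N <= k)%N -> forall t, texh ax n t -> `|val (V N) t y - val (V k) t y| < e.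
  move=> e0; have e30 : 0 < e / 3 by rewrite divr_gt0.
  have [j yj] := xd y _ e30.
  (* [N] must exceed [j] and [n], so that tightness at stage [N] covers [x j] on [texh ax n], and
     [N0], so that its bound [1/(N+1)] is below [e / 3]. *)
  have [N0 _ HN0] := (cvgr0Pnorm_lt _).1 (@cvg_natSinv R) _ e30.
  pose N := maxn (maxn j n) N0; exists N => k Nk t tn.
  have close m u v : `|val (V m) t u - val (V m) t v| = `|u - v|.
    have := semigroup_linear (Cs_semigroup (V m)) t (-1) v u.
    by rewrite !scaleN1r ![- _ + _]addrC => <-; rewrite isoV.
  rewrite -(subrKA (val (V N) t (x j))) -[X in _ + X](subrKA (val (V k) t (x j))).
  rewrite (split_third e) -[ltRHS]addrA (le_lt_trans (ler_normD _ _))// ltrD ?close//.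
  rewrite (le_lt_trans (ler_normD _ _))// ltrD ?close//; last by rewrite distrC.
  rewrite distrC.
  have := (stP N).2 (V k) (bl_mono _ _ Nk _ (bl_self k)) (isoV k) j t.
  move=> le1; apply: le_lt_trans (le1 _ _) _.
  - by rewrite /N !leq_max leqnn.
  - by apply: texh_mono tn; rewrite /N !leq_max leqnn orbT.
  - by have := HN0 N; rewrite /= ger0_norm ?invr_ge0//; apply; rewrite leq_maxr.
have [S isoS VS] := isometric_limit isoV Vc.
have blS k : bl (st k) S.
  apply: (Cs_ball_limit (V := V)) => //.
  by exists k => // j /= kj; exact: bl_mono kj _ (bl_self j).
exists S; split; first exact: st0O (blS 0%N).
by move=> k _; have [] := bl_next k S (blS k.+1).
Qed.

End baire.

Theorem theorem1p20 (R : realType) (H : completeNormedModType R[i])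
    (dot : {dot H for @Num.conj R[i]})
    (norm_dot : forall x : H, `|x| ^+ 2 = dot x x)
    (sepH : separable_space H) (infH : ~ finite_dimensional H) :
  baire_space (Cs dot (rplus R)) /\ baire_space (Cs dot nat).
Proof.
by split; apply: (Cs_baire norm_dot infH sepH);
  [exact: rplus_time_axis | exact: nat_time_axis].
Qed.
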